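(* (i) For each $n\ge1$, the eigenvalues of $\bar{\mathbb{B}}_n$ on polynomials are the numbers $\eta_k^{(n)}=\frac{(n-1)!}{(n+k-1)!}\,n^k$, $k\ge 0$ (with $0\le k\le n$ for $\bar{\mathbb{B}}_n:\Pi_n\to\Pi_n$). (ii) Let $k\ge2$ and $n\ge1$. The monic polynomial $q_k^{(n)}(x)=\sum_{j=0}^k a(n,k,j)x^j$ of degree $k$ with $\bar{\mathbb{B}}_nq_k^{(n)}=\eta_k^{(n)}q_k^{(n)}$ has coefficients given by $a(n,k,k)=1$ and, for $i=k-1,k-2,\dots,0$, $$a(n,k,i)=\frac{\sum_{j=i+1}^k(-1)^{j-i-1}s(j,i)\,(n+j)(n+j+1)\cdots(n+k-1)\,a(n,k,j)}{(n+i)(n+i+1)\cdots(n+k-1)-n^{k-i}}.$$ (iii) For $k\ge 2$ and $0\le j\le k$, $$\lim_{n\to\infty}a(n,k,j)=\prod_{l=1}^{k-j}\frac{(k+1-l)(k-l)}{l(l-2k+1)}.$$ (iv) Put $q_0^{(n)}(x)=1$, $q_1^{(n)}(x)=x-\frac12$. For every $k\ge0$, uniformly on $[0,1]$, $$\lim_{n\to\infty}q_k^{(n)}(x)=\lim_{n\to\infty}p_k^{(n)}(x)=p_k^*(x),$$ where $p_0^*(x)=1$, $p_1^*(x)=x-\frac12$ and $p_k^*(x)=\frac{k!\,(k-2)!}{(2k-2)!}\,x(x-1)P_{k-2}^{(1,1)}(2x-1)$ for $k\ge2$.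
   Context: $\Pi_n$ is the space of polynomials of degree at most $n$. The genuine Beta operator $\bar{\mathbb{B}}_n:C[0,1]\to C[0,1]$ is defined by $\bar{\mathbb{B}}_n(f;0)=f(0)$, $\bar{\mathbb{B}}_n(f;1)=f(1)$, and for $x\in(0,1)$ $$\bar{\mathbb{B}}_n(f;x)=\frac{1}{B(nx,n(1-x))}\int_0^1 t^{nx-1}(1-t)^{n(1-x)-1}f(t)\,dt,$$ where $B(\cdot,\cdot)$ is the Euler Beta function; it maps polynomials of degree $k$ to polynomials of degree $k$. $s(j,i)$ are the (signed) Stirling numbers of the first kind: $y(y-1)\cdots(y-j+1)=\sum_{i=0}^js(j,i)y^i$. Empty products equal $1$. $P_m^{(1,1)}$ are the Jacobi polynomials (standard normalization, $P_m^{(1,1)}(1)=m+1$), orthogonal with respect to the weight $(1-t)(1+t)$ on $[-1,1]$. The Bernstein operator is $B_n(f;x)=\sum_{k=0}^n f(k/n)\binom nk x^k(1-x)^{n-k}$. $p_k^{(n)}$ ($0\le k\le n$) are the monic eigenpolynomials of $B_n$: $p_0^{(n)}=1$, $p_1^{(n)}=x-\frac12$, and for $2\le k\le n$, $p_k^{(n)}$ is the monic polynomial of degree $k$ with $B_np_k^{(n)}=\lambda_k^{(n)}p_k^{(n)}$, $\lambda_k^{(n)}=\frac{n!}{(n-k)!\,n^k}$. *)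

(* Defs.v *)
From HB Require Import structures.
From mathcomp Require Import all_boot all_order all_algebra.
From mathcomp Require Import all_classical all_reals all_analysis.

Set Implicit Arguments.
Unset Strict Implicit.
Unset Printing Implicit Defensive.

Import Order.TTheory GRing.Theory Num.Theory.
Import numFieldNormedType.Exports.

Local Open Scope classical_set_scope.
Local Open Scope ring_scope.

(* Signed Stirling numbers of the first kind, as the coefficients of the
   falling factorial. *)
Definition stirling1 (j i : nat) : int :=
  (\prod_(l < j) ('X - (l%:Z)%:P) : {poly int})`_i.

Section operators.
Variable R : realType.
Notation mu := (@lebesgue_measure R).

(* Euler's Beta function at real arguments; the library's [beta_fun] only takes
   natural numbers. *)
Definition euler_beta (a b : R) : R :=
  \int[mu]_(t in `]0, 1[) (t `^ (a - 1) * (1 - t) `^ (b - 1)).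

(* Functions on [0, 1] are represented by total functions on R; only the values
   on [0, 1], of both [f] and [genuine_beta n f], are meaningful. *)
Definition genuine_beta (n : nat) (f : R -> R) (x : R) : R :=
  if x == 0 then f 0
  else if x == 1 then f 1
  else (euler_beta (n%:R * x) (n%:R * (1 - x)))^-1 *
       \int[mu]_(t in `]0, 1[)
         (t `^ (n%:R * x - 1) * (1 - t) `^ (n%:R * (1 - x) - 1) * f t).

Definition bernstein (n : nat) (f : R -> R) (x : R) : R :=
  \sum_(k < n.+1) f (k%:R / n%:R) * 'C(n, k)%:R * x ^+ k * (1 - x) ^+ (n - k).

Definition eigenpoly (T : (R -> R) -> R -> R) (lam : R) (p : {poly R}) : Prop :=
  forall x, 0 <= x <= 1 -> T (fun t => p.[t]) x = lam * p.[x].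

Definition eigenvalue_on (T : (R -> R) -> R -> R) (V : set {poly R})
    (lam : R) : Prop :=
  exists p : {poly R}, [/\ V p, p != 0 & eigenpoly T lam p].

Definition monic_eigenpoly (T : (R -> R) -> R -> R) (k : nat) (lam : R)
    (p : {poly R}) : Prop :=
  [/\ p \is monic, size p = k.+1 & eigenpoly T lam p].

(* Only used for 1 <= n. *)
Definition eta_ (n k : nat) : R :=
  (n.-1)`!%:R / ((n + k).-1)`!%:R * n%:R ^+ k.

(* Only used for k <= n. *)
Definition lambda_ (n k : nat) : R :=
  n`!%:R / ((n - k)`!%:R * n%:R ^+ k).

(* The eigenvalue 1 is double, so the polynomials of degree 0 and 1 are fixed
   by convention. *)
Definition q_ (n k : nat) : {poly R} :=
  match k with
  | 0 => 1
  | 1 => 'X - (2^-1)%:P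
  | _ => xget 0 [set q | monic_eigenpoly (genuine_beta n) k (eta_ n k) q]
  end.

Definition p_ (n k : nat) : {poly R} :=
  match k with
  | 0 => 1
  | 1 => 'X - (2^-1)%:P
  | _ => xget 0 [set p | monic_eigenpoly (bernstein n) k (lambda_ n k) p]
  end.

(* [P] is the Jacobi polynomial of degree [m] with both parameters 1. *)
Definition is_jacobi11 (m : nat) (P : {poly R}) : Prop :=
  [/\ size P = m.+1,
      (forall Q : {poly R}, (size Q <= m)%N ->
        \int[mu]_(t in `[-1, 1]) ((1 - t) * (1 + t) * P.[t] * Q.[t]) = 0) &
      P.[1] = m.+1%:R].

Definition jacobi11 (m : nat) : {poly R} := xget 0 [set P | is_jacobi11 m P].

Definition pstar (k : nat) : {poly R} :=
  match k with
  | 0 => 1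
  | 1 => 'X - (2^-1)%:P
  | _ => (k`!%:R * (k - 2)`!%:R / (2 * k - 2)`!%:R) *:
         ('X * ('X - 1) * (jacobi11 (k - 2) \Po (2 *: 'X - 1)))
  end.

End operators.

(* Main.v *)
(* Both operators send x^j to a polynomial of degree j, so they are triangular in
   the monomial basis; the diagonal entries are the eigenvalues, and since these
   are distinct for degree >= 2, a monic eigenpolynomial of degree k >= 2 exists,
   is unique, and its coefficients solve a triangular recursion. For the Beta
   operator the images of the monomials are quotients of rising factorials, by
   B(a + 1, b) = a / (a + b) B(a, b); for the Bernstein operator b_j = B_n(x^j)
   satisfies b_{j+1} = x b_j + x (1 - x) b_j' / n. In both cases
   2 n (T_n x^j - x^j) tends to x (1 - x) (x^j)'', so the recursions converge to
   the one for the monic polynomial solution C of x (1 - x) C'' = - k (k - 1) C.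
   Writing C = x (x - 1) Q, Green's formula makes Q orthogonal to the lower
   degrees for the weight x (1 - x), which identifies it with a Jacobi polynomial
   up to a factor; the factor is read off at 1, where Q(1) = C'(1) is given by the
   coefficient of x in C through the symmetry x -> 1 - x. *)
Require Import Defs.
From HB Require Import structures.
From mathcomp Require Import all_boot all_order all_algebra.
From mathcomp Require Import all_classical all_reals all_analysis.
From mathcomp Require Import measurable_realfun ring lra zify.

Set Implicit Arguments.
Unset Strict Implicit.
Unset Printing Implicit Defensive.

Import Order.TTheory GRing.Theory Num.Theory.
Import numFieldNormedType.Exports.

Local Open Scope classical_set_scope.
Local Open Scope ring_scope.

(** * Beta integrals *)

Section euler_beta_theory.
Variable R : realType.
Notation mu := (@lebesgue_measure R).

(** Compact exhaustion of []0, 1[], on which the fundamental theorem of calculus applies even when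
    the integrand is singular at 0 or 1. The shift by 3 keeps the two ends in order from [n = 0]
    on. *)
Definition trim_itv (n : nat) : set R := `[n.+3%:R^-1, 1 - n.+3%:R^-1]%classic.

Lemma measurable_trim_itv (n : nat) : measurable (trim_itv n).
Proof. exact: measurable_itv. Qed.

Lemma nondecreasing_trim_itv : nondecreasing_seq trim_itv.
Proof.
apply/nondecreasing_seqP => n; apply/subsetPset; apply: subset_itv;
  rewrite bnd_simp ?lerD2l ?lerN2; by rewrite lef_pV2 ?posrE// ler_nat.
Qed.

Lemma trim_itv_ends (n : nat) :
  0 < (n.+3%:R^-1 : R) /\ n.+3%:R^-1 < (1 - n.+3%:R^-1 : R).
Proof.
have h : (n.+3%:R^-1 : R) <= 3^-1 by rewrite lef_pV2 ?posrE// ler_nat.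
have h0 : 0 < (n.+3%:R^-1 : R) by rewrite invr_gt0.
by move: (n.+3%:R^-1) h h0 => e h h0; split=> //; lra.
Qed.

Lemma trim_itv_sub (n : nat) :
  trim_itv n `<=` `]0, 1[.
Proof.
move=> x; rewrite /trim_itv /= !in_itv /= => /andP[]; have [] := trim_itv_ends n.
by move: (n.+3%:R^-1) => e; lra.
Qed.

Lemma bigcup_trim_itv :
  \bigcup_n trim_itv n = `]0, 1[%classic :> set R.
Proof.
apply/seteqP; split; first by apply: bigcup_sub => n _; exact: trim_itv_sub.
move=> x /=; rewrite in_itv /= => /andP[x0 x1].
have m0 : 0 < Num.min x (1 - x) by rewrite lt_min x0 subr_gt0.
have [n hn] : exists n : nat, n.+3%:R^-1 <= Num.min x (1 - x).
  exists (Num.truncn (Num.min x (1 - x))^-1).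
  rewrite -[leRHS]invrK lef_pV2 ?posrE ?invr_gt0//.
  apply/ltW/(lt_le_trans (truncnS_gt _)).
  by rewrite ler_nat ltnS !leqW.
exists n => //; rewrite /trim_itv /= in_itv /=.
by move: hn; rewrite le_min => /andP[]; move: (n.+3%:R^-1) => e; lra.
Qed.

Lemma continuous_oo_measurable (h : R -> R) :
  {in `]0, 1[, continuous h} -> measurable_fun (`]0, 1[%classic : set R) h.
Proof.
move=> hc; apply: open_continuous_measurable_fun; first exact: itv_open.
by move=> x; rewrite inE => /hc.
Qed.

(** Monotone convergence along the exhaustion; nonnegativity allows the limit to be taken before
    integrability is known. *)
Lemma cvg_trimmed_integral (h : R -> R) :
    (forall x : R, 0 < x < 1 -> 0 <= h x) -> {in `]0, 1[, continuous h} ->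
  (\int[mu]_(x in trim_itv n) (h x)%:E)%E @[n --> \oo] -->
  (\int[mu]_(x in `]0%R, 1%R[) (h x)%:E)%E.
Proof.
move=> h0 hc; rewrite -bigcup_trim_itv.
have mh := continuous_oo_measurable hc.
apply: ge0_nondecreasing_set_cvg_integral => //.
- exact: nondecreasing_trim_itv.
- exact: measurable_trim_itv.
- move=> n; apply/measurable_EFinP.
  by apply: measurable_funS mh => //; exact: trim_itv_sub.
- move=> n x /trim_itv_sub /=; rewrite in_itv /= => hx.
  by rewrite lee_fin h0.
Qed.

Lemma trimmed_FTC2 (F f : R -> R) (n : nat) :
    (forall x : R, 0 < x < 1 -> is_derive x (1:R) F (f x)) ->
    {in `]0, 1[, continuous f} ->
  (\int[mu]_(x in trim_itv n) (f x)%:E =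
   (F (1 - n.+3%:R^-1) - F n.+3%:R^-1)%R%:E)%E.
Proof.
move=> dF cf; have [e0 e1] := trim_itv_ends n.
rewrite /trim_itv; move: (n.+3%:R^-1) e0 e1 => e e0 e1.
have sub x : x \in `[e, 1 - e] -> 0 < x < 1.
  by rewrite in_itv /= => /andP[? ?]; lra.
have cF x : 0 < x < 1 -> {for x, continuous F}.
  move=> x01; apply: differentiable_continuous; apply/derivable1_diffP.
  by have [] := dF x x01.
rewrite (@continuous_FTC2 _ f F)//.
- apply: continuous_in_subspaceT => x; rewrite inE /= => /sub x01.
  by apply: cf; rewrite in_itv.
- split.
  + move=> x hx; have x01 : 0 < x < 1.
      by apply: sub; apply: subset_itv_oo_cc.
    by have [] := dF x x01.
  + by apply: cvg_at_right_filter; apply: cF; lra.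
  + by apply: cvg_at_left_filter; apply: cF; lra.
- move=> x hx; have x01 : 0 < x < 1.
    by apply: sub; apply: subset_itv_oo_cc.
  by have [_] := dF x x01; rewrite derive1E.
Qed.

(** The trimmed integrals are increments of [F], hence at most [M + M], and so is their limit, the
    integral of [f]. *)
Lemma ge0_bounded_primitive_integrable (F f : R -> R) (M : R) :
    (forall x : R, 0 < x < 1 -> is_derive x (1:R) F (f x)) ->
    {in `]0, 1[, continuous f} ->
    (forall x : R, 0 < x < 1 -> 0 <= f x) -> (forall x : R, 0 < x < 1 -> `|F x| <= M) ->
  mu.-integrable `]0, 1[ (EFin \o f).
Proof.
move=> dF cf f0 FM.
have mf := continuous_oo_measurable cf.
apply/integrableP; split; first exact/measurable_EFinP.
rewrite (_ : (fun x => _) = (fun x => `|f x|%:E)); last by [].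
under eq_integral.
  move=> x; rewrite inE /= in_itv /= => x01; rewrite ger0_norm ?f0//; over.
apply: (@le_lt_trans _ _ (M + M)%:E); last by rewrite ltry.
rewrite -(cvg_lim _ (cvg_trimmed_integral f0 cf))//.
apply: lime_le; first by apply/cvg_ex; eexists; exact: cvg_trimmed_integral.
apply: nearW => n; rewrite (trimmed_FTC2 n dF cf) lee_fin.
have [e0 e1] := trim_itv_ends n.
apply: (le_trans (ler_norm _)); apply: (le_trans (ler_normB _ _)).
by move: (n.+3%:R^-1) e0 e1 => e e0 e1; apply: lerD; apply: FM; lra.
Qed.

(** Integration by parts without boundary terms: on the trimmed intervals the integrals of [g] and
    [h] differ by an increment of [F], which tends to 0. The integrands stay separate because
    monotone convergence needs each of them nonnegative, while [g - h] may change sign. *)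
Lemma integral_derive_eq0 (F g h : R -> R) :
    (forall x : R, 0 < x < 1 -> is_derive x (1:R) F (g x - h x)) ->
    {in `]0, 1[, continuous g} -> {in `]0, 1[, continuous h} ->
    (forall x : R, 0 < x < 1 -> 0 <= g x) -> (forall x : R, 0 < x < 1 -> 0 <= h x) ->
    mu.-integrable `]0, 1[ (EFin \o g) -> mu.-integrable `]0, 1[ (EFin \o h) ->
    F x @[x --> 0^'+] --> 0 -> F x @[x --> 1^'-] --> 0 ->
  \int[mu]_(x in `]0, 1[) g x = \int[mu]_(x in `]0, 1[) h x.
Proof.
move=> dF cg ch g0 h0 ig ih F0 F1.
have trimi (k : R -> R) n : mu.-integrable `]0, 1[ (EFin \o k) ->
    mu.-integrable (trim_itv n) (EFin \o k).
  by apply: integrableS => //; [exact: measurable_trim_itv|exact: trim_itv_sub].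
have lim (k : R -> R) : {in `]0, 1[, continuous k} -> (forall x : R, 0 < x < 1 -> 0 <= k x) ->
    mu.-integrable `]0, 1[ (EFin \o k) ->
    (\int[mu]_(x in trim_itv n) k x) @[n --> \oo] -->
    (\int[mu]_(x in `]0, 1[) k x).
  move=> ck k0 ik; apply: fine_cvg.
  rewrite fineK; first exact: cvg_trimmed_integral.
  exact: integrable_fin_num.
have cgh := cvgB (FF := @eventually_filter) (lim g cg g0 ig) (lim h ch h0 ih).
apply/eqP; rewrite -subr_eq0; apply/eqP.
suff lim0 : F (1 - n.+3%:R^-1) - F n.+3%:R^-1 @[n --> \oo] --> (0 : R).
  move: cgh; rewrite [X in X @ _](_ : _ = fun n : nat => F (1 - n.+3%:R^-1) - F n.+3%:R^-1).
    by move=> cgh; exact: (cvg_unique _ cgh lim0).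
  apply/funext => n.
  rewrite -[LHS]RintegralB; [|exact: measurable_trim_itv|exact: trimi|exact: trimi].
  rewrite /Rintegral (trimmed_FTC2 n dF)//.
  by move=> x x01; apply: cvgB; [exact: cg|exact: ch].
have e0 : (fun n : nat => n.+3%:R^-1 : R) @ \oo --> (0 : R).
  rewrite (_ : (fun n : nat => n.+3%:R^-1) =
     (fun n => (harmonic (n + 2)%N : R))); last first.
    by apply/funext => n; rewrite /harmonic addn2.
  have := @cvg_harmonic R.
  by rewrite -(cvg_shiftn 2).
rewrite -[X in _ --> X](subrr (0:R)).
apply: cvgB.
- move/cvg_at_leftP : F1; apply; split.
    by move=> n; have [] := trim_itv_ends n; move: (n.+3%:R^-1) => e; lra.
  by rewrite -[X in _ --> X](subr0 (1:R)); apply: cvgB => //; exact: cvg_cst.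
- move/cvg_at_rightP : F0; apply; split => //.
Qed.

(** * The Beta weight and its moments *)

Lemma is_derive_powRr (a x : R) : 0 < x ->
  is_derive x (1 : R) (fun t => t `^ a) (a * x `^ (a - 1)).
Proof. exact: is_derive1_powR. Qed.

Lemma is_derive_powR_onem (b x : R) : x < 1 ->
  is_derive x (1 : R) (fun t => (1 - t) `^ b) (- (b * (1 - x) `^ (b - 1))).
Proof.
move=> x1; have h : 0 < 1 - x by rewrite subr_gt0.
have d1 : is_derive x (1 : R) (fun t : R => 1 - t) (-1).
  rewrite -(sub0r (1 : R)).
  exact: (is_deriveB (is_derive_cst (1 : R) x 1) (is_derive_id x 1)).
have := @is_derive1_comp _ (@powR R ^~ b) (fun t : R => 1 - t) x _ _ (is_derive1_powR b h) d1.
by rewrite mulrN1.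
Qed.

Lemma powR_le1 (y c : R) : 0 < y <= 1 -> 0 < c -> y `^ c <= 1.
Proof. by move=> y01 c0; rewrite -(powRr0 y); apply: ger_powR => //; exact: ltW. Qed.

Definition beta_weight (a b t : R) : R := t `^ (a - 1) * (1 - t) `^ (b - 1).

Lemma beta_weight_gt0 (a b t : R) : 0 < t < 1 -> 0 < beta_weight a b t.
Proof. by move=> /andP[t0 t1]; rewrite mulr_gt0// powR_gt0// subr_gt0. Qed.

Lemma beta_weight_ge0 (a b t : R) : 0 < t < 1 -> 0 <= beta_weight a b t.
Proof. by move=> t01; exact/ltW/beta_weight_gt0. Qed.

Lemma is_derive_continuous (f : R -> R) (x d : R) :
  is_derive x (1 : R) f d -> {for x, continuous f}.
Proof.
by move=> [df _]; apply: differentiable_continuous; apply/derivable1_diffP.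
Qed.

Lemma beta_weight_continuous (a b : R) : {in `]0, 1[, continuous (beta_weight a b)}.
Proof.
move=> x; rewrite in_itv /= => /andP[x0 x1]; apply: cvgM.
  exact: (is_derive_continuous (is_derive_powRr _ x0)).
exact: (is_derive_continuous (is_derive_powR_onem _ x1)).
Qed.

(** The weight is dominated by [t ^ (a - 1) + (1 - t) ^ (b - 1)], whose terms have the bounded
    primitives [t ^ a / a] and [- (1 - t) ^ b / b]. *)
Lemma beta_weight_integrable (a b : R) : 0 < a -> 0 < b ->
  mu.-integrable `]0, 1[ (EFin \o beta_weight a b).
Proof.
move=> a0 b0.
have i1 : mu.-integrable `]0, 1[ (EFin \o (fun t : R => t `^ (a - 1))).
  apply: (@ge0_bounded_primitive_integrable (fun t => a^-1 * t `^ a) _ a^-1).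
  - move=> x /andP[x0 x1].
    have := @is_deriveZ _ _ _ _ a^-1 x 1 _ (is_derive_powRr a x0).
    by rewrite /GRing.scale /= mulrA mulVf ?mul1r// gt_eqF.
  - move=> x; rewrite in_itv /= => /andP[x0 x1].
    exact: (is_derive_continuous (is_derive_powRr _ x0)).
  - by move=> x _; exact: powR_ge0.
  - move=> x /andP[x0 x1].
    rewrite ger0_norm ?mulr_ge0 ?powR_ge0 ?invr_ge0 ?(ltW a0) ?(ltW b0)//.
    rewrite -[leRHS]mulr1 ler_pM2l ?invr_gt0//.
    by apply: powR_le1; lra.
have i2 : mu.-integrable `]0, 1[ (EFin \o (fun t : R => (1 - t) `^ (b - 1))).
  apply: (@ge0_bounded_primitive_integrable (fun t => - b^-1 * (1 - t) `^ b) _ b^-1).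
  - move=> x /andP[x0 x1].
    have := @is_deriveZ _ _ _ _ (- b^-1) x 1 _ (is_derive_powR_onem b x1).
    by rewrite /GRing.scale /= mulrNN mulrA mulVf ?mul1r// gt_eqF.
  - move=> x; rewrite in_itv /= => /andP[x0 x1].
    exact: (is_derive_continuous (is_derive_powR_onem _ x1)).
  - by move=> x _; exact: powR_ge0.
  - move=> x /andP[x0 x1].
    rewrite mulNr normrN ger0_norm ?mulr_ge0 ?powR_ge0 ?invr_ge0 ?(ltW a0) ?(ltW b0)//.
    rewrite -[leRHS]mulr1 ler_pM2l ?invr_gt0//.
    by apply: powR_le1; lra.
have i12 := integrableD _ i1 i2.
apply: (le_integrable _ _ _ (i12 _)); [exact: measurable_itv| | |exact: measurable_itv].
  apply/measurable_EFinP; apply: continuous_oo_measurable.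
  exact: beta_weight_continuous.
move=> x /=; rewrite in_itv /= => x01; rewrite lee_fin.
have [x0 x1] := andP x01; have x1' : 0 < 1 - x by rewrite subr_gt0.
rewrite ger0_norm ?beta_weight_ge0// ger0_norm ?addr_ge0 ?powR_ge0//.
(* w = (1 - t) w + t w *)
have -> : beta_weight a b x =
    x `^ (a - 1) * (1 - x) `^ b + x `^ a * (1 - x) `^ (b - 1).
  rewrite -(mulr_powRB1 (ltW x0) a0) -(mulr_powRB1 (ltW x1') b0) /beta_weight.
  by ring.
apply: lerD; [apply: ler_piMr|apply: ler_piMl]; rewrite ?powR_ge0//; apply: powR_le1; lra.
Qed.

Lemma mul_beta_weightl (a b t : R) : 0 < t -> t * beta_weight a b t = beta_weight (a + 1) b t.
Proof.
move=> t0; rewrite /beta_weight mulrA; congr (_ * _).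
rewrite -{1}(powRr1 (ltW t0)) -powRD; last by rewrite (gt_eqF t0) implybT.
by congr (_ `^ _); ring.
Qed.

Lemma powR_onem_cvg0 (b : R) : 0 < b -> (1 - t) `^ b @[t --> 1^'-] --> (0 : R).
Proof.
move=> b0; apply/cvg_at_leftP => u [u1 uc].
have /cvg_at_rightP := @powR_cvg0 _ b b0; apply; split.
  by move=> n; rewrite subr_gt0.
by rewrite -[X in _ --> X](subrr (1:R)); apply: cvgB => //; exact: cvg_cst.
Qed.

(** The function [t ^ a * (1 - t) ^ b] vanishes at both ends, and its derivative is [a - (a + b) t]
    times the weight with parameters [a] and [b]. *)
Lemma euler_betaS (a b : R) : 0 < a -> 0 < b ->
  euler_beta (a + 1) b = a / (a + b) * euler_beta a b.
Proof.
move=> a0 b0; have ab0 : 0 < a + b by lra.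
have iw c d : 0 < c -> 0 < d -> mu.-integrable `]0, 1[ (EFin \o beta_weight c d).
  exact: beta_weight_integrable.
suff : a * euler_beta a b = (a + b) * euler_beta (a + 1) b.
  by move=> h; apply: (mulfI (lt0r_neq0 ab0)); rewrite -h mulrA mulrCA divff ?mulr1 ?lt0r_neq0.
have i1 := iw a b a0 b0; have i2 := iw (a + 1) b (addr_gt0 a0 ltr01) b0.
rewrite /euler_beta -!RintegralZl//.
apply: (@integral_derive_eq0 (fun t => t `^ a * (1 - t) `^ b)).
- move=> x /andP[x0 x1]; have x1' : 0 < 1 - x by rewrite subr_gt0.
  have := @is_deriveM _ _ _ _ x 1 _ _ (is_derive_powRr a x0) (is_derive_powR_onem b x1).
  congr is_derive; rewrite /GRing.scale /=.
  rewrite -(mulr_powRB1 (ltW x1') b0) -(mulr_powRB1 (ltW x0) a0) addrK.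
  rewrite -(mulr_powRB1 (ltW x0) a0); ring.
- by move=> x hx; apply: cvgM; [exact: cvg_cst|exact: beta_weight_continuous].
- by move=> x hx; apply: cvgM; [exact: cvg_cst|exact: beta_weight_continuous].
- by move=> x hx; rewrite mulr_ge0 ?(ltW a0) ?(beta_weight_ge0 _ _ hx).
- by move=> x hx; rewrite mulr_ge0 ?(ltW ab0) ?(beta_weight_ge0 _ _ hx).
- by apply: (integrableZl _ a i1); exact: measurable_itv.
- by apply: (integrableZl _ (a + b) i2); exact: measurable_itv.
- rewrite -[X in _ --> X](mul0r ((1 - 0) `^ b)); apply: cvgM; first exact: powR_cvg0.
  apply: cvg_at_right_filter.
  exact: (is_derive_continuous (is_derive_powR_onem b ltr01)).
- rewrite -[X in _ --> X](mulr0 (1 `^ a)); apply: cvgM; last exact: powR_onem_cvg0.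
  apply: cvg_at_left_filter.
  exact: (is_derive_continuous (is_derive_powRr a ltr01)).
Qed.

(** The weight is at least [c] on the middle third [trim_itv 0]: for [1/3 <= y < 1],
    [y ^ (d - 1) >= y ^ d >= 3 ^ (- d)], whatever the sign of [d - 1]. *)
Lemma euler_beta_gt0 (a b : R) : 0 < a -> 0 < b -> 0 < euler_beta a b.
Proof.
move=> a0 b0.
have iw := beta_weight_integrable a0 b0.
pose c : R := (3%:R^-1 `^ a * 3%:R^-1 `^ b).
have c0 : 0 < c by rewrite mulr_gt0// powR_gt0// invr_gt0.
have le_int : (\int[mu]_(x in trim_itv 0) c <= euler_beta a b).
  rewrite /Rintegral fine_le//.
  - rewrite integral_cst; last exact: measurable_trim_itv.
    by rewrite /trim_itv /= lebesgue_measure_itv /=; case: ifP.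
  - exact: integrable_fin_num.
  apply: (@le_trans _ _ (\int[mu]_(x in trim_itv 0) (beta_weight a b x)%:E)%E).
    apply: ge0_le_integral => //.
    - exact: measurable_trim_itv.
    - by move=> x _; rewrite lee_fin ltW.
    - apply/measurable_EFinP.
      apply: measurable_funS (continuous_oo_measurable (@beta_weight_continuous a b)) => //.
      exact: trim_itv_sub.
    - move=> x xin; rewrite lee_fin.
      have := trim_itv_sub xin; rewrite /= in_itv /= => /andP[x0 x1].
      move: xin; rewrite /trim_itv /= in_itv /= => /andP[hx1 hx2].
      have key (y d : R) : 3^-1 <= y -> y < 1 -> 0 < d -> 3^-1 `^ d <= y `^ (d - 1).
        move=> y3 y1 d0; have y0 : 0 < y by lra.
        apply: (@le_trans _ _ (y `^ d)).
          by apply: ge0_ler_powR; rewrite ?nnegrE//; lra.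
        rewrite -(mulr_powRB1 (ltW y0) d0) ler_piMl ?powR_ge0//; exact: ltW.
      by apply: ler_pM; rewrite ?powR_ge0//; apply: key => //; lra.
  apply: ge0_subset_integral => //.
  - exact: measurable_trim_itv.
  - by case/integrableP: iw.
  - by move=> x /=; rewrite in_itv /= => h; rewrite lee_fin beta_weight_ge0.
  - exact: trim_itv_sub.
apply: lt_le_trans le_int.
rewrite Rintegral_cst; last exact: measurable_trim_itv.
rewrite mulr_gt0// /trim_itv /= lebesgue_measure_itv /= lte_fin.
by rewrite ifT /=; lra.
Qed.

(** Each factor [t] raises the first parameter by 1, so the moment is a shifted Beta value, and
    [euler_betaS] unrolls the shift. *)
Lemma beta_weight_moment (a b : R) (j : nat) : 0 < a -> 0 < b ->
  \int[mu]_(t in `]0, 1[) (beta_weight a b t * t ^+ j) =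
  (\prod_(l < j) ((a + l%:R) / (a + b + l%:R))) * euler_beta a b.
Proof.
move=> a0 b0.
have -> : \int[mu]_(t in `]0, 1[) (beta_weight a b t * t ^+ j) =
    euler_beta (a + j%:R) b.
  apply: eq_Rintegral => t; rewrite inE /= in_itv /= => /andP[t0 t1].
  elim: j => [|j IH]; first by rewrite expr0 mulr1 addr0.
  by rewrite exprSr mulrA IH mulrC mul_beta_weightl// -addrA natr1.
elim: j => [|j IH]; first by rewrite big_ord0 mul1r addr0.
rewrite big_ord_recr /= -natr1 addrA euler_betaS// ?IH.
  by rewrite (addrAC a) mulrA (mulrC (_ / _)).
by rewrite (lt_le_trans a0)// lerDl.
Qed.

End euler_beta_theory.

(** * Triangular operators on polynomials *)

Section triangular_operators.
Variable F : fieldType.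
Implicit Types (t : nat -> {poly F}) (p q : {poly F}).

(** The linear operator with ['X^j |-> t j]. The Beta operator, the Bernstein operator and their
    second-order limit are all handled in this form. *)
Definition triop t p : {poly F} := \sum_(j < size p) p`_j *: t j.

Lemma triop_widen t p (N : nat) : (size p <= N)%N ->
  triop t p = \sum_(j < N) p`_j *: t j.
Proof.
move=> sN; rewrite /triop -!(big_mkord xpredT (fun j => p`_j *: t j)).
rewrite [RHS](big_cat_nat (n := size p))//=.
rewrite [X in _ = _ + X]big_nat_cond [X in _ = _ + X]big1 ?addr0//.
by move=> j /andP[/andP[/(nth_default 0)-> _] _]; rewrite scale0r.
Qed.

Lemma triopD t p q : triop t (p + q) = triop t p + triop t q.
Proof.
pose N := maxn (size p) (size q).
rewrite (@triop_widen _ (p + q) N) ?size_polyD// (@triop_widen _ p N) ?leq_maxl//.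
rewrite (@triop_widen _ q N) ?leq_maxr// -big_split /=.
by apply: eq_bigr => j _; rewrite coefD scalerDl.
Qed.

Lemma triopZ t c p : triop t (c *: p) = c *: triop t p.
Proof.
rewrite (@triop_widen _ (c *: p) (size p)) ?size_scale_leq// scaler_sumr.
by apply: eq_bigr => j _; rewrite coefZ scalerA.
Qed.

Lemma triopB t p q : triop t (p - q) = triop t p - triop t q.
Proof. by rewrite triopD -scaleN1r triopZ scaleN1r. Qed.

Lemma triopXn t j : triop t 'X^j = t j.
Proof.
rewrite (@triop_widen _ _ j.+1) ?size_polyXn// big_ord_recr /= coefXn eqxx scale1r.
by rewrite big1 ?add0r// => i _; rewrite coefXn (ltn_eqF (ltn_ord i)) scale0r.
Qed.

Variable t : nat -> {poly F}.
Hypothesis tri : forall j, (size (t j) <= j.+1)%N.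

Lemma coef_triop p (k i : nat) : (size p <= k.+1)%N ->
  (triop t p)`_i = \sum_(i <= j < k.+1) p`_j * (t j)`_i.
Proof.
move=> sp; rewrite (triop_widen t sp) coef_sum.
rewrite -(big_mkord xpredT (fun j => (p`_j *: t j)`_i)).
have ci j : (p`_j *: t j)`_i = p`_j * (t j)`_i by rewrite coefZ.
rewrite (eq_bigr _ (fun j _ => ci j)).
have [ik|ki] := leqP i k.+1; last first.
  rewrite [RHS]big_geq; last exact: ltnW.
  rewrite big_nat_cond big1// => j /andP[/andP[_ jk] _].
  by rewrite [(t j)`_i]nth_default ?mulr0// (leq_trans (tri j))// (leq_trans jk) 1?ltnW.
rewrite (big_cat_nat (n := i))//= [X in X + _ = _]big_nat_cond.
rewrite [X in X + _ = _]big1 ?add0r// => j /andP[/andP[_ ji] _].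
by rewrite [(t j)`_i]nth_default ?mulr0// (leq_trans (tri j)).
Qed.

Lemma lead_triop p (k : nat) : (size p <= k.+1)%N ->
  (triop t p)`_k = p`_k * (t k)`_k.
Proof. by move=> sp; rewrite (coef_triop _ sp) big_nat1. Qed.

(** A triangular operator multiplies the leading coefficient by the diagonal entry of that
    degree. *)
Lemma triop_eigenvalue p lam : p != 0 -> triop t p = lam *: p ->
  lam = (t (size p).-1)`_(size p).-1.
Proof.
move=> p0 Ep; have sp : (size p <= (size p).-1.+1)%N by rewrite leqSpred.
have := lead_triop sp; rewrite Ep coefZ mulrC => /mulfI; apply.
by rewrite -lead_coefE lead_coef_eq0.
Qed.

Variable k : nat.
Hypothesis simple : forall i, (i < k)%N -> (t i)`_i != (t k)`_k.

(** Back substitution: start from ['X^k], whose residual in the eigenvalue equation has degree below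
    [k], and add each lower monomial in turn with the multiple that kills the top coefficient of the
    residual. After [k] corrections nothing is left. *)
Lemma triop_eigenpoly_exists :
  exists p, [/\ p \is monic, size p = k.+1 & triop t p = (t k)`_k *: p].
Proof.
have step m : (m <= k)%N -> exists p, [/\ p \is monic, size p = k.+1 &
    (size (triop t p - (t k)`_k *: p)%R <= k - m)%N].
  elim: m => [_|m IH mk].
    exists 'X^k; rewrite monicXn size_polyXn triopXn subn0; split=> //.
    apply/leq_sizeP => i ik; rewrite coefB coefZ coefXn.
    have [->|nik] := eqVneq i k; first by rewrite mulr1 subrr.
    by rewrite mulr0 subr0 nth_default// (leq_trans (tri k))// ltn_neqAle eq_sym nik.
  have [p [mp sp rp]] := IH (ltnW mk).
  pose s := (k - m.+1)%N; have sk : (s < k)%N by rewrite /s ltn_subrL (leq_trans _ mk).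
  have ss : (k - m)%N = s.+1 by rewrite /s subnSK.
  pose r := triop t p - (t k)`_k *: p; rewrite ss -/r in rp.
  have dn : (t k)`_k - (t s)`_s != 0 by rewrite subr_eq0 eq_sym simple.
  (* Adding [c *: 'X^s] changes coefficient [s] of the residual by [c] times the diagonal entry at
     [s] minus the one at [k]. *)
  pose c := r`_s / ((t k)`_k - (t s)`_s).
  have szc : (size (c *: 'X^s)%R < size p)%N.
    by rewrite sp ltnS (leq_trans (size_scale_leq _ _))// size_polyXn.
  exists (p + c *: 'X^s); split.
  - by rewrite monicE lead_coefDl// -monicE.
  - by rewrite size_polyDl// sp.
  - rewrite -/s triopD triopZ triopXn scalerDr.
    rewrite (_ : _ - _ = r + c *: (t s - (t k)`_k *: 'X^s)); last first.
      rewrite /r scalerBr opprD addrACA; congr (_ + _ + (_ - _)).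
      by rewrite !scalerA mulrC.
    rewrite /c; move: r rp {c szc} => r rp.
    apply/leq_sizeP => i; rewrite leq_eqVlt => /predU1P[<-|si].
      rewrite coefD coefZ coefB coefZ coefXn eqxx mulr1.
      by rewrite -[X in _ * X]opprB mulrN divfK ?subrr.
    rewrite coefD coefZ coefB coefZ coefXn (gtn_eqF si) mulr0 subr0.
    rewrite (nth_default 0 (leq_trans rp si)).
    by rewrite (nth_default 0 (leq_trans (tri s) si)) mulr0 addr0.
have [p [mp sp]] := step k (leqnn k).
rewrite subnn leqn0 size_poly_eq0 subr_eq0 => /eqP Ep.
by exists p.
Qed.

(** The difference of two solutions has degree below [k]; were it nonzero, its eigenvalue would also
    be a diagonal entry of index below [k]. *)
Lemma triop_eigenpoly_unique p q :
  p \is monic -> size p = k.+1 -> triop t p = (t k)`_k *: p ->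
  q \is monic -> size q = k.+1 -> triop t q = (t k)`_k *: q -> p = q.
Proof.
move=> mp sp Ep mq sq Eq; apply/eqP; rewrite -subr_eq0; apply: contraT => d0.
have Ed : triop t (p - q) = (t k)`_k *: (p - q) by rewrite triopB Ep Eq scalerBr.
have sd : (size (p - q)%R < k.+1)%N.
  rewrite ltnS; apply/leq_sizeP => j; rewrite leq_eqVlt coefB => /predU1P[<-|kj].
    move: mp mq; rewrite !monicE !lead_coefE sp sq /= => /eqP-> /eqP->.
    by rewrite subrr.
  by rewrite !nth_default ?sp ?sq ?subr0.
have := triop_eigenvalue d0 Ed; move/esym/eqP; apply: contraTT => _.
apply: simple; have : (0 < size (p - q)%R)%N by rewrite size_poly_gt0.
by case: (size _) sd.
Qed.

(** The downward recursion for the coefficients: by triangularity, the eigenvalue equation at degree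
    [i] only involves coefficients of index [i] and above. *)
Lemma triop_eigenpoly_coef p (i : nat) : size p = k.+1 ->
    triop t p = (t k)`_k *: p -> (i < k)%N ->
  p`_i * ((t k)`_k - (t i)`_i) = \sum_(i.+1 <= j < k.+1) p`_j * (t j)`_i.
Proof.
move=> sp Ep ik; have := congr1 (fun q => q`_i) Ep.
rewrite /= coefZ (@coef_triop _ k) ?sp// [X in X = _ -> _]big_ltn; last by rewrite ltnS ltnW.
by move=> h; rewrite mulrBr [p`_i * (t k)`_k]mulrC -h addrAC subrr add0r.
Qed.

End triangular_operators.

(** * The genuine Beta operator on polynomials *)

Section beta_monomials.
Variable R : realType.

(** The image of [x ^ j] under the Beta operator: the rising factorial of [n x] of length [j],
    divided by that of [n]. *)
Definition beta_mono (n j : nat) : {poly R} :=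
  \prod_(l < j) ((n%:R + l%:R)^-1 *: (n%:R *: 'X + (l%:R)%:P)).

Lemma beta_monoS (n j : nat) : beta_mono n j.+1 =
  (n%:R + j%:R)^-1 *: (n%:R *: ('X * beta_mono n j) + j%:R *: beta_mono n j).
Proof.
rewrite /beta_mono big_ord_recr /= mulrC -scalerAl mulrDl -scalerAl.
by rewrite mul_polyC.
Qed.

Lemma size_beta_mono (n j : nat) : (size (beta_mono n j) <= j.+1)%N.
Proof.
elim: j => [|j IH]; first by rewrite /beta_mono big_ord0 size_poly1.
rewrite beta_monoS; apply: (leq_trans (size_scale_leq _ _)).
apply: (leq_trans (size_polyD _ _)); rewrite geq_max; apply/andP; split.
  apply: (leq_trans (size_scale_leq _ _)).
  rewrite mulrC; have [->|p0] := eqVneq (beta_mono n j) 0; first by rewrite mul0r size_poly0.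
  by rewrite size_mulX.
by apply: (leq_trans (size_scale_leq _ _)); apply: (leq_trans IH).
Qed.

(** The rising factorial of [n x] is, up to [(-1) ^ j], the falling factorial of [- n x], whose
    coefficients are Stirling numbers. The induction checks that both sides obey the same recurrence
    in [j]. *)
Lemma coef_beta_mono_stirling (n j i : nat) :
  (\prod_(l < j) (n%:R + l%:R)) != 0 :> R ->
  (beta_mono n j)`_i =
  (-1) ^+ (j + i) * n%:R ^+ i * (stirling1 j i)%:~R / \prod_(l < j) (n%:R + l%:R).
Proof.
rewrite /stirling1; elim: j i => [|j IH] i.
  rewrite /beta_mono !big_ord0 !coef1 divr1.
  by case: i => [|i] _ /=; rewrite ?mulr0 ?mulr1 ?expr0 ?mulr1.
rewrite beta_monoS big_ord_recr /= mulf_eq0 negb_or => /andP[P0 j0].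
rewrite coefZ coefD !coefZ coefXM !(IH _ P0) big_ord_recr /=.
rewrite mulrBr coefB coefMX coefMC rmorphB rmorphM /=.
have -> : (j%:Z)%:~R = j%:R :> R by [].
move: (\prod_(l < j) (n%:R + l%:R)) P0 => P P0.
move: (\prod_(l < j) ('X - (l%:Z)%:P)) => S.
case: i => [|i] /=.
  rewrite rmorph0 !addn0 expr0 exprS.
  by field; rewrite ?P0 ?j0.
by rewrite !addSn !addnS !exprS; field; rewrite ?P0 ?j0.
Qed.

Lemma beta_prod_neq0 (n j : nat) : (1 <= n)%N -> \prod_(l < j) (n%:R + l%:R) != 0 :> R.
Proof.
by move=> n1; apply/prodf_neq0 => l _; rewrite -natrD pnatr_eq0 addn_eq0 negb_and -lt0n n1.
Qed.

Lemma lead_beta_mono (n j : nat) : (beta_mono n j)`_j =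
  n%:R ^+ j / \prod_(l < j) (n%:R + l%:R).
Proof.
elim: j => [|j IH]; first by rewrite /beta_mono !big_ord0 coef1 divr1.
rewrite beta_monoS coefZ coefD !coefZ coefXM IH /= (nth_default 0 (size_beta_mono n j)).
by rewrite mulr0 addr0 big_ord_recr /= invfM exprS mulrC !mulrA.
Qed.

Lemma eta_prodE (n j : nat) : (1 <= n)%N ->
  eta_ R n j = n%:R ^+ j / \prod_(l < j) (n%:R + l%:R).
Proof.
case: n => // n _; rewrite /eta_ /=.
have -> : (n + j)`!%:R = n`!%:R * \prod_(l < j) (n.+1%:R + l%:R) :> R.
  elim: j => [|j IH]; first by rewrite big_ord0 mulr1 addn0.
  by rewrite big_ord_recr /= mulrA -IH addnS factS natrM mulrC -natrD addSn.
have : n`!%:R != 0 :> R by rewrite pnatr_eq0 -lt0n fact_gt0.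
by move: (n`!%:R : R) => f f0; rewrite invfM mulrA divff // mul1r mulrC.
Qed.

Lemma lead_beta_monoE (n j : nat) : (1 <= n)%N -> (beta_mono n j)`_j = eta_ R n j.
Proof. by move=> n1; rewrite lead_beta_mono eta_prodE. Qed.

Lemma eta_gt0 (n k : nat) : (1 <= n)%N -> 0 < eta_ R n k.
Proof.
move=> n1; rewrite /eta_ mulr_gt0 ?exprn_gt0 ?divr_gt0 ?ltr0n ?fact_gt0//.
Qed.

Lemma etaS (n k : nat) : (1 <= n)%N -> eta_ R n k.+1 = eta_ R n k * (n%:R / (n%:R + k%:R)).
Proof.
move=> n1; rewrite !eta_prodE// big_ord_recr /= exprSr invfM; ring.
Qed.

(** Consecutive eigenvalues have ratio [n / (n + k)], which is below 1 except at [k = 0]; the strict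
    decrease therefore starts at index 1. *)
Lemma eta_lt (n i k : nat) : (1 <= n)%N -> (1 <= i)%N -> (i < k)%N ->
  eta_ R n k < eta_ R n i.
Proof.
move=> n1 i1; elim: k => // k IH; rewrite ltnS leq_eqVlt => ik.
have step : (1 <= k)%N -> eta_ R n k.+1 < eta_ R n k.
  move=> k1; rewrite etaS// gtr_pMr ?eta_gt0// ltr_pdivrMr ?mul1r ?ltrDl ?ltr0n//.
  by rewrite -natrD ltr0n addn_gt0 n1.
case/predU1P: ik => [ik|ik]; first by move: i1; rewrite ik; exact: step.
by apply: (lt_trans _ (IH ik)); apply: step; exact: leq_ltn_trans ik.
Qed.

Lemma eta0 (n : nat) : (1 <= n)%N -> eta_ R n 0 = 1.
Proof. by move=> n1; rewrite eta_prodE// big_ord0 divr1. Qed.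

Lemma eta1 (n : nat) : (1 <= n)%N -> eta_ R n 1 = 1.
Proof. by move=> n1; rewrite etaS// eta0// addr0 mul1r divff// pnatr_eq0 -lt0n. Qed.

Lemma eta_neq (n i k : nat) : (1 <= n)%N -> (2 <= k)%N -> (i < k)%N ->
  eta_ R n i != eta_ R n k.
Proof.
move=> n1 k2; case: i => [|i] ik; last by rewrite gt_eqF// eta_lt.
by rewrite eta0// -(eta1 n1) gt_eqF// eta_lt.
Qed.

Lemma horner_beta_mono (n j : nat) (x : R) :
  (beta_mono n j).[x] = \prod_(l < j) ((n%:R * x + l%:R) / (n%:R + l%:R)).
Proof.
rewrite /beta_mono horner_prod; apply: eq_bigr => l _.
by rewrite !hornerE mulrC.
Qed.

Notation mu := (@lebesgue_measure R).

(** Inside the interval, linearity reduces the claim to the moments of the Beta weight. At 0 every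
    product with [0 < j] contains the vanishing factor [l = 0], and at 1 all factors are 1. *)
Lemma genuine_beta_horner (n : nat) (p : {poly R}) (x : R) :
  (1 <= n)%N -> 0 <= x <= 1 ->
  genuine_beta n (fun t => p.[t]) x = (triop (beta_mono n) p).[x].
Proof.
move=> n1 /andP[x0 x1]; have n0 : 0 < n%:R :> R by rewrite ltr0n.
rewrite /triop horner_sum; under eq_bigr do rewrite hornerZ horner_beta_mono.
rewrite /genuine_beta; case: eqVneq => [->|nx0].
  rewrite horner_coef; apply: eq_bigr => -[j /= _] _; congr (_ * _).
  rewrite expr0n; case: j => [|j]; first by rewrite big_ord0.
  by rewrite big_ord_recl /= mulr0 addr0 mul0r mul0r.
case: eqVneq => [->|nx1].
  rewrite horner_coef; apply: eq_bigr => -[j /= _] _; congr (_ * _).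
  rewrite expr1n big1// => l _; rewrite mulr1 divff//.
  by rewrite -natrD pnatr_eq0 addn_eq0 negb_and -lt0n n1.
have a0 : 0 < n%:R * x by rewrite mulr_gt0// lt_neqAle eq_sym nx0.
have b0 : 0 < n%:R * (1 - x) by rewrite mulr_gt0// subr_gt0 lt_neqAle nx1.
(* The parameters add up to [n], so the denominators of the moments do not depend on [x]. *)
have abn : n%:R * x + n%:R * (1 - x) = n%:R by rewrite -mulrDr addrC subrK mulr1.
move: (n%:R * x) (n%:R * (1 - x)) a0 b0 abn => a b a0 b0 abn.
have B0 := euler_beta_gt0 a0 b0.
have iw0 j : mu.-integrable `]0, 1[ (EFin \o (fun t : R => beta_weight a b t * t ^+ j)).
  apply: (le_integrable _ _ _ (beta_weight_integrable a0 b0)).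
  - exact: measurable_itv.
  - apply/measurable_EFinP; apply: continuous_oo_measurable => t t01; apply: cvgM.
      exact: beta_weight_continuous.
    exact: exprn_continuous.
  - move=> t /=; rewrite in_itv /= => t01; rewrite lee_fin.
    have [t0 t1] := andP t01; have w0 := beta_weight_ge0 a b t01.
    have tj0 : 0 <= t ^+ j by rewrite exprn_ge0// ltW.
    have tj1 : t ^+ j <= 1 by rewrite exprn_ile1 ?(ltW t0) ?(ltW t1).
    by rewrite (ger0_norm w0) (ger0_norm (mulr_ge0 w0 tj0)) ler_piMr.
have iw j : mu.-integrable `]0, 1[
    (EFin \o (fun t : R => p`_j * (beta_weight a b t * t ^+ j))).
  by apply: (integrableZl _ p`_j (iw0 j)); exact: measurable_itv.
(* Integrability and value go through one induction, since additivity of the integral requires the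
   partial sum to be integrable. *)
have sumE (N : nat) :
    mu.-integrable `]0, 1[ (EFin \o (fun t : R =>
      \sum_(j < N) p`_j * (beta_weight a b t * t ^+ j))) /\
    \int[mu]_(t in `]0, 1[) (\sum_(j < N) p`_j * (beta_weight a b t * t ^+ j)) =
    \sum_(j < N) p`_j * ((\prod_(l < j) ((a + l%:R) / (n%:R + l%:R))) * euler_beta a b).
  elim: N => [|N [iN IH]].
    under [X in EFin \o X]eq_fun do rewrite big_ord0.
    under eq_Rintegral do rewrite big_ord0.
    rewrite big_ord0; split; first exact: integrable0.
    by rewrite Rintegral_cst// mul0r.
  under [X in EFin \o X]eq_fun do rewrite big_ord_recr.
  under eq_Rintegral do rewrite big_ord_recr.
  split; first by apply: (integrableD _ iN (iw N)); exact: measurable_itv.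
  rewrite RintegralD; [|exact: measurable_itv|exact: iN|exact: iw].
  rewrite IH big_ord_recr /= RintegralZl; [|exact: measurable_itv|exact: iw0].
  congr (_ + _ * _); rewrite beta_weight_moment//.
  by congr (_ * _); apply: eq_bigr => l _; rewrite abn.
have -> : \int[mu]_(t in `]0, 1[) (t `^ (a - 1) * (1 - t) `^ (b - 1) * p.[t]) =
    \int[mu]_(t in `]0, 1[) (\sum_(j < size p) p`_j * (beta_weight a b t * t ^+ j)).
  apply: eq_Rintegral => t _; rewrite horner_coef mulr_sumr.
  by apply: eq_bigr => j _; rewrite mulrCA.
rewrite (sumE _).2 mulr_sumr; apply: eq_bigr => j _.
by rewrite mulrC -!mulrA mulfV ?mulr1// gt_eqF.
Qed.

End beta_monomials.

(** * The Bernstein operator on polynomials *)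

Section bernstein_monomials.
Variable R : realType.

Definition bern_mono (n j : nat) : {poly R} :=
  \sum_(k < n.+1) ((k%:R / n%:R) ^+ j * 'C(n, k)%:R) *: ('X^k * (1 - 'X) ^+ (n - k)).

Lemma bern_mono0 (n : nat) : bern_mono n 0 = 1.
Proof.
rewrite -[RHS](expr1n _ n) -[X in _ = X ^+ n](subrK ('X : {poly R}) 1) exprDn.
apply: eq_bigr => k _; rewrite expr0 mul1r mulrC.
by rewrite scaler_nat.
Qed.

(** The logarithmic derivative of [x ^ k (1 - x) ^ (n - k)] is [k / x - (n - k) / (1 - x)], and
    [k (1 - x) - (n - k) x = k - n x]. *)
Lemma X1X_deriv_bernstein_basis (n k : nat) : (k <= n)%N ->
  'X * (1 - 'X) * ('X^k * (1 - 'X) ^+ (n - k))^`() =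
  (k%:R%:P - n%:R *: 'X) * ('X^k * (1 - 'X) ^+ (n - k)) :> {poly R}.
Proof.
move=> kn; rewrite -[in n%:R](subnK kn) natrD.
move: (n - k)%N => m.
have dX : 'X * 'X^k^`() = k%:R *: 'X^k :> {poly R}.
  rewrite derivXn; case: k {kn} => [|k]; first by rewrite mulr0n mulr0 scale0r.
  by rewrite mulrnAr -exprS scaler_nat.
have dY : (1 - 'X) * ((1 - 'X) ^+ m)^`() = - m%:R *: (1 - 'X) ^+ m :> {poly R}.
  rewrite deriv_exp derivB derivC derivX sub0r mulN1r.
  case: m => [|m]; first by rewrite mulr0n mulr0 oppr0 scale0r.
  by rewrite mulrnAr mulrN -exprS /= scaleNr scaler_nat mulNrn.
rewrite derivM mulrDr.
have -> : 'X * (1 - 'X) * ('X^k^`() * (1 - 'X) ^+ m) =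
  ('X * 'X^k^`()) * (1 - 'X) * (1 - 'X) ^+ m :> {poly R} by ring.
have -> : 'X * (1 - 'X) * ('X^k * ((1 - 'X) ^+ m)^`()) =
  'X * 'X^k * ((1 - 'X) * ((1 - 'X) ^+ m)^`()) :> {poly R} by ring.
rewrite dX dY -!mul_polyC polyCN polyCD; ring.
Qed.

(** By the preceding identity, multiplying a basis term by [k / n] amounts to applying
    [x + (x (1 - x) / n) d/dx], an operator that no longer depends on [k]. *)
Lemma bern_monoS (n j : nat) : (1 <= n)%N ->
  bern_mono n j.+1 =
  'X * bern_mono n j + n%:R^-1 *: ('X * (1 - 'X) * (bern_mono n j)^`()).
Proof.
move=> n1; have n0 : n%:R != 0 :> R by rewrite pnatr_eq0 -lt0n.
rewrite /bern_mono raddf_sum /= !mulr_sumr scaler_sumr -big_split /=.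
apply: eq_bigr => -[k /= kn] _.
rewrite derivZ -!scalerAr X1X_deriv_bernstein_basis //.
move: ('X^k * (1 - 'X) ^+ (n - k)) => P.
rewrite exprSr -!mul_polyC !polyCM.
have : (n%:R^-1)%:P * n%:R%:P = 1 :> {poly R} by rewrite -polyCM mulVf.
move: (n%:R^-1%:P) (n%:R%:P) (_ ^+ j)%:P ('C(n, k)%:R%:P) (k%:R%:P) => a b c d e ab.
transitivity (c * d * 'X * P + a * c * d * e * P - a * b * (c * d * 'X * P)); last by ring.
by rewrite ab; ring.
Qed.

Lemma coef_X1X_mul (p : {poly R}) (i : nat) :
  ('X * (1 - 'X) * p)`_i.+1 = p`_i - (if i is l.+1 then p`_l else 0).
Proof.
rewrite -mulrA coefXM /= mulrBl mul1r coefB coefXM.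
by case: i.
Qed.

Lemma size_bern_mono (n j : nat) : (1 <= n)%N -> (size (bern_mono n j) <= j.+1)%N.
Proof.
move=> n1; elim: j => [|j IH]; first by rewrite bern_mono0 size_poly1.
rewrite bern_monoS//; apply/leq_sizeP => -[//|i]; rewrite ltnS => ji.
rewrite coefD coefXM coefZ coef_X1X_mul !coef_deriv /=.
rewrite ![(bern_mono n j)`_i.+1]nth_default ?(leq_trans IH)// ?leqW//.
rewrite (nth_default 0 (leq_trans IH ji)) mul0rn sub0r.
case: i ji => [|i] ji; first by rewrite oppr0 mulr0 addr0.
by rewrite coef_deriv (nth_default 0 (leq_trans IH ji)) mul0rn oppr0 mulr0 addr0.
Qed.

(** For [b] of degree at most [j], the coefficient of degree [j + 1] in [x (1 - x) b'] is [- j]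
    times that of degree [j] in [b]. *)
Lemma lead_bern_monoS (n j : nat) : (1 <= n)%N ->
  (bern_mono n j.+1)`_j.+1 = (bern_mono n j)`_j * (1 - j%:R / n%:R).
Proof.
move=> n1; rewrite bern_monoS// coefD coefXM coefZ coef_X1X_mul /= coef_deriv.
rewrite (nth_default 0 (size_bern_mono j n1)) mul0rn sub0r.
case: j => [|j]; first by rewrite oppr0 mulr0 mul0r subr0 mulr1 addr0.
rewrite coef_deriv -mulr_natr; ring.
Qed.

Lemma lead_bern_monoE (n k : nat) : (1 <= n)%N -> (k <= n)%N ->
  (bern_mono n k)`_k = lambda_ R n k.
Proof.
move=> n1; have n0 : n%:R != 0 :> R by rewrite pnatr_eq0 -lt0n.
have f0 m : m`!%:R != 0 :> R by rewrite pnatr_eq0 -lt0n fact_gt0.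
elim: k => [|k IH] kn.
  by rewrite bern_mono0 coef1 /lambda_ subn0 expr0 mulr1 divff.
rewrite lead_bern_monoS// IH 1?ltnW// /lambda_ -(subnSK kn) factS natrM exprSr.
rewrite (subnSK kn) natrB 1?ltnW//.
have nk : n%:R - k%:R != 0 :> R by rewrite -natrB 1?ltnW// pnatr_eq0 subn_eq0 -ltnNge.
have := f0 (n - k.+1)%N; move: (n - k.+1)`!%:R => f1 h1.
have : n%:R ^+ k != 0 :> R by rewrite expf_neq0.
move: (n%:R ^+ k : R) (n`!%:R : R) => x y x0.
by field; rewrite ?x0 ?n0 ?nk ?h1.
Qed.

Lemma lambda_gt0 (n k : nat) : (1 <= n)%N -> 0 < lambda_ R n k.
Proof.
by move=> n1; rewrite /lambda_ divr_gt0 ?mulr_gt0 ?exprn_gt0 ?ltr0n ?fact_gt0.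
Qed.

(** The ratio of consecutive eigenvalues is [1 - j / n]: it is 1 at [j = 0] and below 1 afterwards,
    so the eigenvalues decrease strictly from index 1 on, and index 0 is referred to index 1. *)
Lemma lambda_neq (n i k : nat) : (2 <= k)%N -> (k <= n)%N -> (i < k)%N ->
  lambda_ R n i != lambda_ R n k.
Proof.
move=> k2 kn ik; have n1 : (1 <= n)%N by apply: leq_trans kn; exact: ltnW.
have n0 : 0 < n%:R :> R by rewrite ltr0n.
have S j : (j < n)%N -> lambda_ R n j.+1 = lambda_ R n j * (1 - j%:R / n%:R).
  by move=> jn; rewrite -!lead_bern_monoE ?lead_bern_monoS// ltnW.
have le1 j : (j < n)%N -> (1 <= j)%N -> lambda_ R n j.+1 < lambda_ R n j.
  move=> jn j1; rewrite S// gtr_pMr ?lambda_gt0// gtrDl oppr_lt0.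
  by rewrite divr_gt0// ltr0n.
have lt j : (1 <= i)%N -> (i < j)%N -> (j <= n)%N -> lambda_ R n j < lambda_ R n i.
  move=> i1; elim: j => // j IH; rewrite ltnS leq_eqVlt => /predU1P[<-|ij] jn.
    exact: le1.
  by apply: (lt_trans _ (IH ij (ltnW jn))); apply: le1 => //; exact: leq_ltn_trans ij.
case: i ik lt => [|i] ik lt; last by rewrite gt_eqF// lt.
have e1 : lambda_ R n 1 = lambda_ R n 0 by rewrite S// mul0r subr0 mulr1.
rewrite -e1 gt_eqF//.
elim: k k2 kn {ik lt} => // k IH; rewrite ltnS leq_eqVlt => /predU1P[<-|k1] kn.
  exact: le1.
by apply: (lt_trans _ (IH k1 (ltnW kn))); apply: le1 => //; exact: ltnW.
Qed.

Lemma bernstein_horner (n : nat) (p : {poly R}) (x : R) :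
  bernstein n (fun t => p.[t]) x = (triop (bern_mono n) p).[x].
Proof.
rewrite /bernstein /triop horner_sum.
under [RHS]eq_bigr => j _.
  rewrite hornerZ /bern_mono horner_sum mulr_sumr.
  over.
rewrite exchange_big /=; apply: eq_bigr => k _.
rewrite horner_coef -!mulrA mulr_suml; apply: eq_bigr => j _.
rewrite hornerZ hornerM hornerXn horner_exp hornerD hornerN hornerC hornerX.
by rewrite !mulrA.
Qed.

End bernstein_monomials.

(** * Coefficientwise limits of eigenpolynomials *)

Section coefficientwise_limits.
Variable R : realType.
Implicit Types (p q : nat -> {poly R}).

Lemma cvg_seq_sum (I : eqType) (r : seq I) (f : I -> nat -> R) (l : I -> R) :
  (forall i, i \in r -> f i @ \oo --> l i) ->
  \sum_(i <- r) f i n @[n --> \oo] --> \sum_(i <- r) l i.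
Proof.
elim: r => [_|i r IH h].
  by rewrite big_nil; under eq_fun do rewrite big_nil; exact: cvg_cst.
rewrite big_cons; under eq_fun do rewrite big_cons.
apply: cvgD; first by apply: h; rewrite mem_head.
by apply: IH => j jr; apply: h; rewrite in_cons jr orbT.
Qed.

Lemma near_eq_cvg_seq (u v : nat -> R) (l : R) : (\forall n \near \oo, u n = v n) ->
  u @ \oo --> l -> v @ \oo --> l.
Proof. by move=> uv; apply: cvg_trans; exact: near_eq_cvg uv. Qed.

(** Limits are taken coefficient by coefficient, which suits the triangular recursions; a common
    degree bound later turns this into uniform convergence on [[0, 1]]. *)
Definition coef_cvg p (l : {poly R}) := forall i, (fun n => (p n)`_i) @ \oo --> l`_i.

Lemma coef_cvg_cst (l : {poly R}) : coef_cvg (fun=> l) l.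
Proof. by move=> i; exact: cvg_cst. Qed.

Lemma coef_cvgD p q l m : coef_cvg p l -> coef_cvg q m ->
  coef_cvg (fun n => p n + q n) (l + m).
Proof.
move=> pl qm i; rewrite coefD; under eq_fun do rewrite coefD.
exact: cvgD.
Qed.

Lemma coef_cvgM p q l m : coef_cvg p l -> coef_cvg q m ->
  coef_cvg (fun n => p n * q n) (l * m).
Proof.
move=> pl qm i; rewrite coefM; under eq_fun do rewrite coefM.
apply: cvg_seq_sum => j _; exact: cvgM.
Qed.

Lemma coef_cvgZ (c : nat -> R) (d : R) p l : c @ \oo --> d -> coef_cvg p l ->
  coef_cvg (fun n => c n *: p n) (d *: l).
Proof.
move=> cd pl i; rewrite coefZ; under eq_fun do rewrite coefZ.
exact: cvgM.
Qed.

Lemma coef_cvg_deriv p l : coef_cvg p l -> coef_cvg (fun n => (p n)^`()) l^`().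
Proof.
move=> pl i; rewrite coef_deriv -mulr_natr.
under eq_fun do rewrite coef_deriv -mulr_natr.
by apply: cvgM => //; exact: cvg_cst.
Qed.

Lemma near_coef_cvg p q l : (\forall n \near \oo, p n = q n) ->
  coef_cvg p l -> coef_cvg q l.
Proof.
move=> pq pl i; apply: near_eq_cvg_seq (pl i).
by apply: filterS pq => n ->.
Qed.

Lemma near_ge (N : nat) : \forall n \near \oo, (N <= n)%N.
Proof. by exists N. Qed.

Lemma cvg_invn : (fun n : nat => n%:R^-1 : R) @ \oo --> (0 : R).
Proof.
have := @cvg_harmonic R; rewrite /harmonic -[X in X -> _]/((fun n => n.+1%:R^-1) @ _ --> _).
by rewrite (cvg_shiftS (fun n : nat => n%:R^-1 : R)).
Qed.

(* [lim_mono j] is [x (1 - x) (x ^ j)'']; the predecessors are harmless, the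
   factor being 0 for [j <= 1]. *)
Definition lim_mono (j : nat) : {poly R} := (j * j.-1)%:R *: ('X^(j.-1) - 'X^j).

(** Leibniz rule [(x f)'' = x f'' + 2 f'] at [f = x ^ j], multiplied by [x (1 - x)]. *)
Lemma lim_monoS (j : nat) :
  lim_mono j.+1 = 'X * lim_mono j + (2 * j)%:R *: ((1 - 'X) * 'X^j).
Proof.
rewrite /lim_mono; case: j => [|j /=]; first by rewrite !muln0 !scale0r mulr0 addr0.
rewrite mulrBl mul1r -exprS -scalerAr mulrBr -!exprS -scalerDl -natrD.
by congr (_%:R *: _); lia.
Qed.

(** For [n >= 1], [t n - 'X^j] is [1 / (2 n)] times a convergent sequence. *)
Lemma coef_cvg_of_second_order (t : nat -> {poly R}) (j : nat) (l : {poly R}) :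
  coef_cvg (fun n => (2 * n)%:R *: (t n - 'X^j)) l -> coef_cvg t 'X^j.
Proof.
move=> tl; rewrite -['X^j]addr0 -(scale0r l) addrC.
apply: (@near_coef_cvg (fun n => (2%:R^-1 * n%:R^-1) *: ((2 * n)%:R *: (t n - 'X^j)) + 'X^j)).
  apply: filterS (near_ge 1) => n n1; rewrite scalerA natrM.
  rewrite [X in X *: _](_ : _ = 1) ?scale1r ?subrK//.
  have n0 : n%:R != 0 :> R by rewrite pnatr_eq0 -lt0n.
  by field; rewrite n0.
apply: coef_cvgD; last exact: coef_cvg_cst.
apply: coef_cvgZ => //; rewrite -[X in _ --> X](mulr0 2%:R^-1).
by apply: cvgM; [exact: cvg_cst|exact: cvg_invn].
Qed.

Lemma beta_mono_second_order (j : nat) :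
  coef_cvg (fun n => (2 * n)%:R *: (beta_mono R n j - 'X^j)) (lim_mono j).
Proof.
elim: j => [|j IH].
  rewrite /lim_mono mul0n scale0r; apply: (@near_coef_cvg (fun=> 0)); last exact: coef_cvg_cst.
  by apply: nearW => n; rewrite /beta_mono big_ord0 expr0 subrr scaler0.
have bj := coef_cvg_of_second_order IH.
rewrite lim_monoS.
(* Exact recursion for the rescaled error; [2 n j / (n + j)] is put in the form [2 j / (1 + j / n)]
   so that its limit [2 j] is visible. *)
apply: (@near_coef_cvg (fun n => 'X * ((2 * n)%:R *: (beta_mono R n j - 'X^j)) +
   ((2 * j)%:R / (1 + j%:R * n%:R^-1)) *: ((1 - 'X) * beta_mono R n j))).
  apply: filterS (near_ge 1) => n n1.
  have n0 : n%:R != 0 :> R by rewrite pnatr_eq0 -lt0n.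
  have nj0 : n%:R + j%:R != 0 :> R by rewrite -natrD pnatr_eq0 addn_eq0 negb_and -lt0n n1.
  rewrite beta_monoS exprS; move: (beta_mono R n j) => B; move: ('X^j) => Y.
  have -> : (2 * j)%:R / (1 + j%:R / n%:R) = (2 * n)%:R * j%:R / (n%:R + j%:R) :> R.
    by rewrite !natrM; field; rewrite n0 nj0.
  have : ((n%:R + j%:R)^-1)%:P * (n%:R%:P + j%:R%:P) = 1 :> {poly R}.
    by rewrite -polyCD -polyCM mulVf.
  rewrite -!mul_polyC !polyCM.
  move: (((n%:R + j%:R)^-1)%:P) (n%:R%:P) (j%:R%:P) ((2 * n)%:R%:P) => c N J D cNJ.
  (* The first summand is 0, as [c] inverts [N + J]; including it makes the identity purely
     formal. *)
  transitivity (D * 'X * B * (1 - c * (N + J)) + D * (c * (N * ('X * B) + J * B) - 'X * Y)).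
    by ring.
  by rewrite cNJ subrr mulr0 add0r.
apply: coef_cvgD; first by apply: coef_cvgM => //; exact: coef_cvg_cst.
apply: coef_cvgZ; last by apply: coef_cvgM => //; exact: coef_cvg_cst.
rewrite -[X in _ --> X]divr1; apply: cvgM; first exact: cvg_cst.
apply: cvgV; first exact: oner_neq0.
rewrite -[X in _ --> X]addr0; apply: cvgD; first exact: cvg_cst.
rewrite -[X in _ --> X](mulr0 j%:R).
by apply: cvgM; [exact: cvg_cst|exact: cvg_invn].
Qed.

Lemma bern_mono_second_order (j : nat) :
  coef_cvg (fun n => (2 * n)%:R *: (bern_mono R n j - 'X^j)) (lim_mono j).
Proof.
elim: j => [|j IH].
  rewrite /lim_mono mul0n scale0r; apply: (@near_coef_cvg (fun=> 0)); last exact: coef_cvg_cst.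
  by apply: nearW => n; rewrite bern_mono0 expr0 subrr scaler0.
have bj := coef_cvg_of_second_order IH.
rewrite lim_monoS.
(* This gives the limit the shape of the derivative term in [bern_monoS]. *)
have -> : (2 * j)%:R *: ((1 - 'X) * 'X^j) = 2%:R *: ('X * (1 - 'X) * 'X^j^`()) :> {poly R}.
  rewrite derivXn -mulrA [(1 - 'X) * (_ *+ _)]mulrC mulrA mulrnAr.
  rewrite natrM -scalerA; congr (_ *: _); case: j {IH bj} => [|j].
    by rewrite scale0r mulr0n mul0r.
  by rewrite /= -exprS mulrnAl scaler_nat mulrC.
apply: (@near_coef_cvg (fun n => 'X * ((2 * n)%:R *: (bern_mono R n j - 'X^j)) +
   2%:R *: ('X * (1 - 'X) * (bern_mono R n j)^`()))).
  apply: filterS (near_ge 1) => n n1.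
  have n0 : n%:R != 0 :> R by rewrite pnatr_eq0 -lt0n.
  rewrite bern_monoS// exprS addrAC -mulrBr [RHS]scalerDr [in RHS]scalerAr; congr (_ + _).
  by rewrite scalerA natrM mulfK.
apply: coef_cvgD; first by apply: coef_cvgM => //; exact: coef_cvg_cst.
apply: coef_cvgZ; first exact: cvg_cst.
apply: coef_cvgM; first exact: coef_cvg_cst.
exact: coef_cvg_deriv.
Qed.

Lemma size_lim_mono (j : nat) : (size (lim_mono j) <= j.+1)%N.
Proof.
apply: (leq_trans (size_scale_leq _ _)); apply: (leq_trans (size_polyD _ _)).
rewrite size_polyN !size_polyXn geq_max leqnn andbT ltnS; exact: leq_pred.
Qed.

Lemma coef_lim_mono (j i : nat) :
  (lim_mono j)`_i = (j * j.-1)%:R * ((i == j.-1)%:R - (i == j)%:R).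
Proof. by rewrite coefZ coefB !coefXn. Qed.

Lemma lead_lim_mono (j : nat) : (lim_mono j)`_j = - (j * j.-1)%:R.
Proof.
rewrite coef_lim_mono eqxx; case: j => [|j]; first by rewrite mul0r oppr0.
by rewrite /= (gtn_eqF (ltnSn j)) sub0r mulrN1.
Qed.

Lemma lead_lim_mono_neq (i k : nat) : (2 <= k)%N -> (i < k)%N ->
  (lim_mono i)`_i != (lim_mono k)`_k.
Proof.
move=> k2 ik; rewrite !lead_lim_mono eqr_opp eqr_nat.
rewrite neq_ltn; apply/orP; left.
case: k k2 ik => [//|[//|k]] _; case: i => [|i] ik; first by [].
rewrite /=; nia.
Qed.

Lemma lim_eigenpoly_exists (k : nat) : (2 <= k)%N -> exists C : {poly R},
  [/\ C \is monic, size C = k.+1 & triop lim_mono C = (lim_mono k)`_k *: C].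
Proof.
move=> k2; apply: triop_eigenpoly_exists; first exact: size_lim_mono.
by move=> i; exact: lead_lim_mono_neq.
Qed.

(** Scaled by [2 n], the recursion [triop_eigenpoly_coef] for [q n] has entries converging to those
    of the recursion for [C], and its denominator has a nonzero limit. The coefficients then
    converge one after the other, from the top down. *)
Lemma eigenpoly_coef_cvg (t : nat -> nat -> {poly R}) q (C : {poly R}) (k : nat) :
    (2 <= k)%N ->
    (\forall n \near \oo, forall j, (size (t n j) <= j.+1)%N) ->
    (forall j, coef_cvg (fun n => (2 * n)%:R *: (t n j - 'X^j)) (lim_mono j)) ->
    (\forall n \near \oo, [/\ q n \is monic, size (q n) = k.+1 &
        triop (t n) (q n) = (t n k)`_k *: q n]) ->
    [/\ C \is monic, size C = k.+1 & triop lim_mono C = (lim_mono k)`_k *: C] ->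
  coef_cvg q C.
Proof.
move=> k2 st tl Hq [mC sC EC].
(* [m] bounds the distance from [i] up to [k], so the induction descends from the leading
   coefficient. *)
suff key m i : (k <= i + m)%N -> (fun n => (q n)`_i) @ \oo --> C`_i.
  by move=> i; apply: (key k); exact: leq_addl.
elim: m i => [|m IH] i kim.
  rewrite addn0 in kim.
  apply: (@near_eq_cvg_seq (fun=> C`_i)); last exact: cvg_cst.
  apply: filterS Hq => n [mq sq _].
  move: kim; rewrite leq_eqVlt => /predU1P[<-|ki].
    by move: mq mC; rewrite !monicE !lead_coefE sq sC /= => /eqP-> /eqP->.
  by rewrite !nth_default ?sC ?sq.
have [ik|ki] := ltnP i k; last first.
  by apply: IH; apply: (leq_trans ki); exact: leq_addr.
(* Both diagonal entries tend to 1; only after scaling by [2 n] does their difference keep a nonzero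
   limit. *)
pose del n := (2 * n)%:R * ((t n k)`_k - (t n i)`_i).
(* Off the diagonal, the subtracted ['X^j] does not contribute to coefficient [i]. *)
have cl j : j != i -> (fun n => (2 * n)%:R * (t n j)`_i) @ \oo --> (lim_mono j)`_i.
  move=> ji; move: (tl j i); under eq_fun do rewrite coefZ coefB coefXn eq_sym (negbTE ji) subr0.
  by [].
have cd : del n @[n --> \oo] --> (lim_mono k)`_k - (lim_mono i)`_i.
  have := cvgB (FF := @eventually_filter) (tl k k) (tl i i).
  apply: near_eq_cvg_seq; apply: nearW => n.
  rewrite /del -[LHS]/(((2 * n)%:R *: (t n k - 'X^k))`_k - ((2 * n)%:R *: (t n i - 'X^i))`_i).
  by rewrite !coefZ !coefB !coefXn !eqxx /=; ring.
have ld0 : (lim_mono k)`_k - (lim_mono i)`_i != 0.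
  by rewrite subr_eq0 eq_sym lead_lim_mono_neq.
have ECi := triop_eigenpoly_coef size_lim_mono sC EC ik.
have -> : C`_i = (\sum_(i.+1 <= j < k.+1) C`_j * (lim_mono j)`_i) /
   ((lim_mono k)`_k - (lim_mono i)`_i) by rewrite -ECi mulfK.
have nd0 : \forall n \near \oo, del n != 0.
  by apply: (cvgr_neq0 _ cd).
apply: (@near_eq_cvg_seq (fun n =>
    (\sum_(i.+1 <= j < k.+1) (q n)`_j * ((2 * n)%:R * (t n j)`_i)) / del n)).
  near=> n.
  have d0 : del n != 0 by near: n.
  have [mq sq Eq] : [/\ q n \is monic, size (q n) = k.+1 &
        triop (t n) (q n) = (t n k)`_k *: q n] by near: n.
  have sn : forall j, (size (t n j) <= j.+1)%N by near: n.
  have h := triop_eigenpoly_coef sn sq Eq ik.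
  apply: (mulIf d0); rewrite divfK// /del [RHS]mulrCA h mulr_sumr.
  by apply: eq_bigr => j _; rewrite mulrCA.
apply: cvgM; last exact: cvgV.
apply: cvg_seq_sum => j; rewrite mem_index_iota => /andP[ij jk].
apply: cvgM; first by apply: IH; apply: (leq_trans kim); rewrite -addSnnS leq_add2r.
by apply: cl; rewrite gtn_eqF.
Unshelve. all: by end_near.
Qed.

End coefficientwise_limits.

(** * The limit eigenpolynomials *)

Section limit_eigenpolynomial.
Variable R : realType.
Notation lim_mono := (lim_mono R).

Lemma triop_lim_mono (p : {poly R}) :
  triop lim_mono p = 'X * (1 - 'X) * p^`()^`().
Proof.
rewrite -[in RHS](coefK p) poly_def !raddf_sum /= mulr_sumr.
apply: eq_bigr => -[j /= _] _; rewrite !derivZ.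
transitivity (p`_j *: ('X * (1 - 'X) * ('X^j)^`()^`())); last by rewrite scalerAr.
congr (_ *: _).
rewrite /lim_mono derivXn; case: j => [|[|j]].
- by rewrite mul0n scale0r mulr0n deriv0 mulr0.
- by rewrite muln0 scale0r /= mulr1n derivC mulr0.
rewrite /= derivMn derivXn /= -mulrnA mulrnAr -[RHS]scaler_nat mulnC; congr (_ *: _).
by rewrite !exprS; ring.
Qed.

Variables (m : nat) (C : {poly R}).
Let k := m.+2.
Hypotheses (mC : C \is monic) (sC : size C = k.+1)
  (EC : triop lim_mono C = (lim_mono k)`_k *: C).

Let kk : R := (k * k.-1)%:R.

Let kk0 : kk != 0.
Proof. by rewrite /kk pnatr_eq0. Qed.

Lemma lim_eigenpoly_ode : 'X * (1 - 'X) * C^`()^`() = - kk *: C.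
Proof. by rewrite -triop_lim_mono EC lead_lim_mono. Qed.

(** [lim_mono j] only has terms of degree [j] and [j - 1], so the general recursion keeps the single
    summand [j = i + 1]. *)
Lemma lim_eigenpoly_coefS (i : nat) : (i < k)%N ->
  C`_i * ((k * k.-1)%:R - (i * i.-1)%:R) = - (i.+1 * i)%:R * C`_i.+1.
Proof.
move=> ik; have := triop_eigenpoly_coef (@size_lim_mono R) sC EC ik.
rewrite !lead_lim_mono big_ltn ?ltnS// big_nat_cond big1 => [|j]; last first.
  move=> /andP[/andP[ij _] _]; rewrite coef_lim_mono.
  by rewrite (ltn_eqF (ltnW ij)) ltn_eqF ?subrr ?mulr0//; case: j ij.
rewrite addr0 coef_lim_mono /= eqxx (ltn_eqF (ltnSn i)) subr0 mulr1 => h.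
apply: oppr_inj; rewrite mulNr opprK [RHS]mulrC -h -mulrN.
by congr (_ * _); rewrite opprB opprK addrC.
Qed.

Lemma lim_eigenpoly_coef (j : nat) : (j <= k)%N ->
  C`_j = \prod_(1 <= l < (k - j).+1)
     ((k%:R + 1 - l%:R) * (k%:R - l%:R) / (l%:R * (l%:R - 2 * k%:R + 1))).
Proof.
move=> jk; rewrite -[in LHS](subKn jk).
have : (k - j <= k)%N by exact: leq_subr.
elim: (k - j)%N => [|s IH] sk.
  by rewrite big_geq// subn0; move: mC; rewrite monicE lead_coefE sC /= => /eqP.
rewrite big_nat_recr //= -(IH (ltnW sk)).
have sk' : (k - s.+1 < k)%N by rewrite ltn_subrL.
have := lim_eigenpoly_coefS sk'; rewrite subnSK//.
have -> : ((k - s) * (k - s.+1))%:R = (k%:R + 1 - s.+1%:R) * (k%:R - s.+1%:R) :> R.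
  by rewrite natrM !natrB// 1?ltnW// -natr1; ring.
(* With [l = s.+1]: [k (k - 1) - (k - l) (k - l - 1) = - l (l - 2 k + 1)]. *)
have -> : (k * k.-1)%:R - ((k - s.+1) * (k - s.+1).-1)%:R =
    - (s.+1%:R * (s.+1%:R - 2 * k%:R + 1)) :> R.
  have h1 (i : nat) : (i * i.-1)%:R = i%:R * (i%:R - 1) :> R.
    case: i => [|i]; first by rewrite mul0n mul0r.
    by rewrite natrM -[X in _ * (X - _)]natr1 addrK.
  by rewrite !h1 natrB//; ring.
move=> h.
have d0 : s.+1%:R * (s.+1%:R - 2 * k%:R + 1) != 0 :> R.
  rewrite mulf_neq0 ?pnatr_eq0// lt_eqF//.
  have : s.+1%:R <= k%:R :> R by rewrite ler_nat.
  have : 2 <= k%:R :> R by rewrite ler_nat.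
  lra.
by apply: (mulIf d0); rewrite -[RHS]mulrA divfK//; apply: oppr_inj; rewrite -mulrN h mulNr mulrC.
Qed.

Lemma coef0_lim_eigenpoly : C`_0 = 0.
Proof.
have := congr1 (fun p : {poly R} => p`_0) lim_eigenpoly_ode.
rewrite /= -mulrA coefXM /= coefZ mulNr => /esym/eqP.
by rewrite oppr_eq0 mulf_eq0 (negbTE kk0) => /eqP.
Qed.

(* Reflection x -> 1 - x commutes with the limit operator. *)
Lemma lim_eigenpoly_sym : (-1) ^+ k *: (C \Po (1 - 'X)) = C.
Proof.
have s2 : size (1 - 'X : {poly R}) = 2%N.
  by rewrite -opprB size_polyN -(polyC1 R) size_XsubC.
have l2 : lead_coef (1 - 'X : {poly R}) = -1.
  by rewrite -opprB lead_coefN -(polyC1 R) lead_coefXsubC.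
have dX : (1 - 'X : {poly R})^`() = -1 by rewrite derivB derivC derivX sub0r.
have n0 : (-1) ^+ k != 0 :> R by rewrite signr_eq0.
apply: (triop_eigenpoly_unique (@size_lim_mono R) (k := k)) => //.
- by move=> i; exact: lead_lim_mono_neq.
- rewrite monicE lead_coefZ lead_coef_comp ?s2// l2 sC /= (eqP mC) mul1r.
  by rewrite -exprMn mulrNN mulr1 expr1n.
- by rewrite size_scale// size_comp_poly2.
rewrite triopZ triop_lim_mono [RHS]scalerA [X in _ = X *: _]mulrC -[RHS]scalerA.
congr (_ *: _).
rewrite deriv_comp dX mulrN1 derivN deriv_comp dX mulrN1 opprK lead_lim_mono.
have := congr1 (fun p => p \Po (1 - 'X)) lim_eigenpoly_ode.
have c1 : 1 \Po (1 - 'X) = 1 :> {poly R} by rewrite -polyC1 comp_polyC.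
rewrite /= comp_polyZ !comp_polyM comp_polyB comp_polyX c1.
by rewrite [X in _ * X * _](_ : _ = 'X) => [<-|]; ring.
Qed.

Let c : R := k`!%:R * (k - 2)`!%:R / (2 * k - 2)`!%:R.

Lemma lim_eigenpoly_coef1 : C`_1 = (-1) ^+ m.+1 * (k`!%:R * m.+1`!%:R / (2 * m.+1)`!%:R).
Proof.
rewrite lim_eigenpoly_coef// subn1 /=.
have f0 (i : nat) : i`!%:R != 0 :> R by rewrite pnatr_eq0 -lt0n fact_gt0.
(* The partial products have a closed form in factorials, proved by induction; the coefficient is
   the case [s = m.+1]. *)
suff key s : (s <= m.+1)%N -> \prod_(1 <= l < s.+1)
     ((k%:R + 1 - l%:R) * (k%:R - l%:R) / (l%:R * (l%:R - 2 * k%:R + 1))) =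
   (-1) ^+ s * (k`!%:R * m.+1`!%:R * (2 * m.+1 - s)`!%:R /
     ((k - s)`!%:R * (m.+1 - s)`!%:R * s`!%:R * (2 * m.+1)`!%:R)) :> R.
  rewrite key// subnn /k subSnn !fact0 (_ : 1`! = 1)%N//.
  have -> : (2 * m.+1 - m.+1)%N = m.+1 by lia.
  congr (_ * _).
  have := f0 m.+1; have := f0 (2 * m.+1)%N.
  move: (m.+1`!%:R) ((2 * m.+1)`!%:R) (m.+2`!%:R) => x y z y0 x0.
  by field; rewrite x0 y0.
elim: s => [_|s IH sm].
  rewrite big_geq// !subn0 expr0 mul1r fact0.
  have := f0 k; have := f0 m.+1; have := f0 (2 * m.+1)%N.
  move: (m.+1`!%:R) ((2 * m.+1)`!%:R) (k`!%:R) => x y z y0 x0 z0.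
  by field; rewrite x0 y0 z0.
rewrite big_nat_recr //= IH 1?ltnW// exprSr.
have kE : k%:R = m.+1%:R + 1 :> R by rewrite natr1.
have e1 : (k - s)`!%:R = (k%:R + 1 - s.+1%:R) * (k - s.+1)`!%:R :> R.
  rewrite (_ : (k - s)%N = (k - s.+1).+1) ?factS ?natrM; last by rewrite /k; lia.
  congr (_ * _); rewrite -natr1 natrB; last by rewrite /k; lia.
  by rewrite ?kE; ring.
have e2 : (m.+1 - s)`!%:R = (k%:R - s.+1%:R) * (m.+1 - s.+1)`!%:R :> R.
  rewrite (_ : (m.+1 - s)%N = (m.+1 - s.+1).+1) ?factS ?natrM; last by lia.
  congr (_ * _); rewrite -natr1 natrB; last by rewrite /k; lia.
  by rewrite ?kE; ring.
have e3 : (2 * m.+1 - s)`!%:R = - (s.+1%:R - 2 * k%:R + 1) * (2 * m.+1 - s.+1)`!%:R :> R.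
  rewrite (_ : (2 * m.+1 - s)%N = (2 * m.+1 - s.+1).+1) ?factS ?natrM; last by lia.
  congr (_ * _); rewrite -natr1 natrB; last by lia.
  by rewrite natrM kE; ring.
have e4 : s.+1`!%:R = s.+1%:R * s`!%:R :> R by rewrite factS natrM.
have := f0 (k - s)%N; have := f0 (m.+1 - s)%N; have := f0 (2 * m.+1 - s)%N.
have := f0 s.+1; have := f0 (2 * m.+1)%N.
rewrite e1 e2 e3 e4 !mulf_eq0 !negb_or oppr_eq0.
move: (k%:R + 1 - s.+1%:R) => a; move: (k%:R - s.+1%:R) => b.
move: (s.+1%:R - 2 * k%:R + 1) => d; move: (s.+1%:R)
  ((m.+1 - s.+1)`!%:R) ((2 * m.+1 - s.+1)`!%:R) (s`!%:R)
  ((2 * m.+1)`!%:R) (k`!%:R) (m.+1`!%:R) ((-1) ^+ s) => e g h i j l o w.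
move=> j0 /andP[e0 i0] /andP[d0 h0] /andP[b0 g0] /andP[a0 _].
by field; rewrite ?j0 ?e0 ?i0 ?d0 ?h0 ?b0 ?g0 ?a0.
Qed.

(** The cofactor of ['X * ('X - 1)] in [C], read off from the differential equation without any
    division of polynomials. *)
Let Q : {poly R} := kk^-1 *: C^`()^`().

Lemma lim_eigenpoly_factor : C = 'X * ('X - 1) * Q.
Proof.
rewrite /Q -scalerAr (_ : 'X * ('X - 1) * C^`()^`() = kk *: C).
  by rewrite scalerA mulVf// scale1r.
by rewrite -opprB mulrN mulNr lim_eigenpoly_ode scaleNr opprK.
Qed.

Lemma lim_eigenpoly_root1 : C.[1] = 0.
Proof.
by rewrite lim_eigenpoly_factor; move: Q => q; rewrite !hornerE subrr !(mul0r, mulr0).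
Qed.

(** Since [x (x - 1)] has value 0 and derivative 1 at 1, [Q.[1]] is the derivative of [C] there,
    which the reflection turns into the coefficient of [x] up to sign. The factor [m.+1] is the
    Jacobi normalization at 1. *)
Lemma lim_eigenpoly_cofactor1 : Q.[1] = c * m.+1%:R.
Proof.
have -> : Q.[1] = C^`().[1].
  rewrite [in RHS]lim_eigenpoly_factor; move: Q => q.
  rewrite !derivM derivX.
  by rewrite derivB derivX derivC !hornerE /=; ring.
rewrite -[in LHS]lim_eigenpoly_sym derivZ deriv_comp derivB derivX derivC sub0r mulrN1.
rewrite hornerZ hornerN horner_comp !hornerE subrr horner_coef0 coef_deriv mulr1n.
rewrite lim_eigenpoly_coef1 /c /k.
have -> : (2 * m.+2 - 2)%N = (2 * m.+1)%N by lia.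
rewrite subSS subSS subn0 (factS m) natrM.
have -> : (-1) ^+ m.+2 = - (-1) ^+ m.+1 :> R by rewrite exprS mulN1r.
have : (-1) ^+ m.+1 * (-1) ^+ m.+1 = 1 :> R by rewrite -exprMn mulrNN mulr1 expr1n.
move: ((-1) ^+ m.+1) ((2 * m.+1)`!%:R^-1) (m.+2`!%:R) (m.+1%:R) (m`!%:R) => w x y z t ww.
by rewrite -[RHS]mul1r -ww; ring.
Qed.

End limit_eigenpolynomial.

(** * Identification with Jacobi polynomials *)

Section polynomials_and_integrals.
Variable R : realType.
Notation mu := (@lebesgue_measure R).
Implicit Types p q A : {poly R}.

Lemma poly_eq0_on01 p : (forall x, 0 <= x <= 1 -> p.[x] = 0) -> p = 0.
Proof.
(* The points [1 / (i + 1)] are distinct elements of [[0, 1]], as many as the size of [p]: too many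
   roots for a nonzero [p]. *)
move=> h; pose rs := [seq (i.+1%:R^-1 : R) | i <- iota 0 (size p)].
apply: (@roots_geq_poly_eq0 _ p rs).
- apply/allP => x /mapP[i _ ->]; apply/rootP; apply: h.
  by rewrite invr_ge0 ler0n invf_le1 ?ltr0n// ler1n.
- rewrite map_inj_uniq ?iota_uniq// => i j /invr_inj/eqP.
  by rewrite eqr_nat eqSS => /eqP.
- by rewrite size_map size_iota.
Qed.

Lemma poly_eq_on01 p q : (forall x, 0 <= x <= 1 -> p.[x] = q.[x]) -> p = q.
Proof.
move=> h; apply/eqP; rewrite -subr_eq0; apply/eqP; apply: poly_eq0_on01 => x x01.
by rewrite hornerD hornerN h// subrr.
Qed.

Lemma Rintegral_horner (a b : R) A p : a < b -> A^`() = p ->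
  \int[mu]_(x in `[a, b]) p.[x] = A.[b] - A.[a].
Proof.
move=> ab Ap; rewrite /Rintegral (@continuous_FTC2 _ (horner p) (horner A))//.
- by apply: continuous_subspaceT => x; exact: continuous_horner.
- split.
  + by move=> x _; exact: derivable_horner.
  + by apply: cvg_at_right_filter; exact: continuous_horner.
  + by apply: cvg_at_left_filter; exact: continuous_horner.
- by move=> x _; rewrite -derivE Ap.
Qed.

Lemma antiderivative_exists p : exists A, A^`() = p.
Proof.
exists (\poly_(i < (size p).+1) (p`_i.-1 / i%:R)).
apply/polyP => i; rewrite coef_deriv coef_poly ltnS /= -[LHS]mulr_natr.
case: ltnP => [ip|pi]; first by rewrite divfK// pnatr_eq0.
by rewrite mul0r nth_default.
Qed.

(** A nondecreasing function with equal end values is constant. This yields that a nonnegative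
    polynomial with integral 0 vanishes. *)
Lemma antiderivative_ge0_const A (a b : R) : a < b ->
  (forall x, a < x < b -> 0 <= (A^`()).[x]) -> A.[a] = A.[b] ->
  forall x, a <= x <= b -> A.[x] = A.[a].
Proof.
move=> ab dA Aab x /andP[ax xb].
have mono : {in `[a, b] &, {homo horner A : x y / x <= y}}.
  apply: ger0_derive1_le_cc.
  - by move=> y _; exact: derivable_horner.
  - by move=> y; rewrite in_itv /= => yab; rewrite -derivE dA.
  - by apply: continuous_subspaceT => y; exact: continuous_horner.
apply/eqP; rewrite eq_le; apply/andP; split.
  by rewrite Aab; apply: mono; rewrite ?in_itv /= ?ax ?xb ?lexx ?(ltW ab).
by apply: mono; rewrite ?in_itv /= ?ax ?xb ?lexx ?(ltW ab).
Qed.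

Let w : {poly R} := (1 - 'X) * (1 + 'X).

Lemma jacobi_weight_horner p q x :
  (1 - x) * (1 + x) * p.[x] * q.[x] = (w * p * q).[x].
Proof. by rewrite !hornerE. Qed.

(** The combination [D] cancels the leading terms, so its degree is below [m] and it is orthogonal
    to both polynomials, hence to itself. Thus [D = 0], the polynomials are proportional, and the
    value at 1 fixes the factor. *)
Lemma is_jacobi11_unique (m : nat) (P1 P2 : {poly R}) :
  is_jacobi11 m P1 -> is_jacobi11 m P2 -> P1 = P2.
Proof.
move=> [s1 o1 n1] [s2 o2 n2].
have l1 : lead_coef P1 != 0 by rewrite lead_coef_eq0 -size_poly_eq0 s1.
pose D := lead_coef P2 *: P1 - lead_coef P1 *: P2.
have sD : (size D <= m)%N.
  apply/leq_sizeP => j; rewrite leq_eqVlt => /predU1P[<-|mj].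
    by rewrite coefB !coefZ !lead_coefE s1 s2 /= mulrC subrr.
  by rewrite coefB !coefZ !nth_default ?s1 ?s2// !mulr0 subrr.
have lt : -1 < 1 :> R by lra.
have [A1 EA1] := antiderivative_exists (w * P1 * D).
have [A2 EA2] := antiderivative_exists (w * P2 * D).
have h1 : A1.[1] - A1.[-1] = 0.
  rewrite -(Rintegral_horner lt EA1) -(o1 _ sD).
  by apply: eq_Rintegral => x _; rewrite jacobi_weight_horner.
have h2 : A2.[1] - A2.[-1] = 0.
  rewrite -(Rintegral_horner lt EA2) -(o2 _ sD).
  by apply: eq_Rintegral => x _; rewrite jacobi_weight_horner.
(* An antiderivative of [w * D * D], with equal values at -1 and 1 by the two orthogonality
   relations. *)
pose A := lead_coef P2 *: A1 - lead_coef P1 *: A2.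
have EA : A^`() = w * D * D.
  by rewrite /A derivB !derivZ EA1 EA2 {3}/D -!mul_polyC; ring.
have A0 : A.[-1] = A.[1].
  apply/eqP; rewrite eq_sym -subr_eq0 /A !hornerD !hornerN !hornerZ.
  have -> : A1.[1] = A1.[-1] by apply/eqP; rewrite -subr_eq0 h1.
  have -> : A2.[1] = A2.[-1] by apply/eqP; rewrite -subr_eq0 h2.
  by rewrite subrr.
have dA x : -1 < x < 1 -> 0 <= (A^`()).[x].
  move=> /andP[x0 x1]; rewrite EA -jacobi_weight_horner -mulrA.
  by rewrite mulr_ge0 -?expr2 ?sqr_ge0// mulr_ge0//; lra.
have cA := antiderivative_ge0_const lt dA A0.
have : A = (A.[-1])%:P.
  by apply: poly_eq_on01 => x /andP[x0 x1]; rewrite hornerC cA//; lra.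
move/(congr1 (@deriv R)); rewrite derivC EA => /eqP.
have w0 : w != 0.
  apply/eqP => /(congr1 (horner^~ 0)); rewrite !hornerE; lra.
rewrite -mulrA mulf_eq0 (negbTE w0) /= mulf_eq0 orbb subr_eq0 => /eqP D0.
have lE : lead_coef P2 = lead_coef P1.
  have := congr1 (horner^~ 1) D0; rewrite /= !hornerZ n1 n2.
  by move/mulIf; apply; rewrite pnatr_eq0.
by move: D0; rewrite lE => /(scalerI l1).
Qed.

Lemma jacobi11E (m : nat) (P : {poly R}) : is_jacobi11 m P -> jacobi11 R m = P.
Proof.
move=> jP; apply: xget_subset1 => //= P1 P2; exact: is_jacobi11_unique.
Qed.

(* [p] has integral 0 over [0, 1]. *)
Definition null01 p := exists2 A, A^`() = p & A.[0] = A.[1].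

Lemma null01D p q : null01 p -> null01 q -> null01 (p + q).
Proof.
move=> [A <- hA] [B <- hB]; exists (A + B); first by rewrite derivD.
by rewrite !hornerD hA hB.
Qed.

Lemma null01Z c p : null01 p -> null01 (c *: p).
Proof.
move=> [A <- hA]; exists (c *: A); first by rewrite derivZ.
by rewrite !hornerZ hA.
Qed.

Lemma null01_0 : null01 0.
Proof. by exists 0; rewrite ?deriv0// !horner0. Qed.

(** Green's formula: [p' q - p q'] is an antiderivative and vanishes at both ends. *)
Lemma null01_green p q : p.[0] = 0 -> p.[1] = 0 -> q.[0] = 0 -> q.[1] = 0 ->
  null01 (p^`()^`() * q - p * q^`()^`()).
Proof.
move=> p0 p1 q0 q1; exists (p^`() * q - p * q^`()).
  by rewrite derivB !derivM; ring.
by rewrite !hornerD !hornerN !hornerM p0 p1 q0 q1 !mulr0 !mul0r.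
Qed.

End polynomials_and_integrals.

Section limit_is_jacobi.
Variable R : realType.
Notation lim_mono := (lim_mono R).
Variables (m : nat) (C : {poly R}).
Let k := m.+2.
Hypotheses (mC : C \is monic) (sC : size C = k.+1)
  (EC : triop lim_mono C = (lim_mono k)`_k *: C).

Let Q : {poly R} := (k * k.-1)%:R^-1 *: C^`()^`().
Let facQ : C = 'X * ('X - 1) * Q := lim_eigenpoly_factor EC.

(** Green's formula is applied to [C] and [h e = x (x - 1) x ^ e]. As [C = x (x - 1) Q] and [C''] is
    a multiple of [Q], the product [C'' * h e] is a multiple of [C x ^ e], while [(h e)''] combines
    [x ^ e] and [x ^ (e - 1)]. Induction on [d] removes the lower term, and the factor left is
    nonzero because [d + 2 < k]. *)
Lemma lim_eigenpoly_null01_Xn (d : nat) : (d < m)%N -> null01 (C * 'X^d).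
Proof.
have kk0 : (k * k.-1)%:R != 0 :> R by rewrite pnatr_eq0.
have C0 : C.[0] = 0 by rewrite horner_coef0 (coef0_lim_eigenpoly EC).
have C1 : C.[1] = 0 by exact: (lim_eigenpoly_root1 EC).
have C2 : C^`()^`() = (k * k.-1)%:R *: Q by rewrite /Q scalerA mulfV// scale1r.
pose h e : {poly R} := 'X^(e.+2) - 'X^(e.+1).
have hfac e : h e = 'X * ('X - 1) * 'X^e by rewrite /h !exprS; ring.
have h0 e : (h e).[0] = 0 by rewrite /h !hornerE !expr0n subrr.
have h1 e : (h e).[1] = 0 by rewrite /h !hornerE !expr1n subrr.
have h2 e : (h e)^`()^`() = (e.+2 * e.+1)%:R *: 'X^e - (e.+1 * e)%:R *: 'X^(e.-1).
  rewrite /h !(derivB, derivXn, derivMn) /= -!mulrnA !scaler_nat.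
  by congr (_ *+ _ - _ *+ _); rewrite mulnC.
have green e : null01 (((k * k.-1)%:R - (e.+2 * e.+1)%:R) *: (C * 'X^e) +
    (e.+1 * e)%:R *: (C * 'X^(e.-1))).
  have := null01_green C0 C1 (h0 e) (h1 e).
  rewrite h2 C2 hfac.
  have -> : (k * k.-1)%:R *: Q * ('X * ('X - 1) * 'X^e) = (k * k.-1)%:R *: (C * 'X^e).
    by rewrite [in RHS]facQ -!mul_polyC; ring.
  by congr null01; rewrite -!mul_polyC polyCB; ring.
have nz e : (e < m)%N -> (k * k.-1)%:R - (e.+2 * e.+1)%:R != 0 :> R.
  move=> em; rewrite subr_eq0 eqr_nat neq_ltn; apply/orP; right.
  by rewrite /k /=; nia.
elim: d => [|d IH] dm.
  have := null01Z ((k * k.-1)%:R - (2 * 1)%:R)^-1 (green 0%N).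
  by rewrite muln0 scale0r addr0 scalerA mulVf ?scale1r// nz.
have := null01D (green d.+1) (null01Z (- (d.+2 * d.+1)%:R) (IH (ltnW dm))).
rewrite /= scaleNr addrK => /(null01Z ((k * k.-1)%:R - (d.+3 * d.+2)%:R)^-1).
by rewrite scalerA mulVf ?scale1r// nz.
Qed.

Lemma lim_eigenpoly_null01 (g : {poly R}) : (size g <= m)%N -> null01 (C * g).
Proof.
move=> sg; rewrite -(coefK g) poly_def mulr_sumr.
elim/big_ind: _ => //; first exact: null01_0; first exact: null01D.
move=> [j /= js] _; rewrite -scalerAr; apply: null01Z.
by apply: lim_eigenpoly_null01_Xn; exact: leq_trans sg.
Qed.

Let c : R := k`!%:R * (k - 2)`!%:R / (2 * k - 2)`!%:R.

Let c0 : c != 0.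
Proof.
by rewrite /c !mulf_neq0 ?invr_eq0 ?pnatr_eq0 -?lt0n ?fact_gt0.
Qed.

(** [up] maps [[-1, 1]] affinely onto [[0, 1]], and [down] is its inverse, the substitution in
    [pstar]. *)
Let up : {poly R} := 2^-1 *: ('X + 1).
Let down : {poly R} := 2 *: 'X - 1.

Let up_down : up \Po down = 'X.
Proof.
rewrite /up /down comp_polyZ comp_polyD comp_polyX -polyC1 comp_polyC polyC1 subrK.
by rewrite scalerA mulVf ?scale1r// pnatr_eq0.
Qed.

Let down_up : down \Po up = 'X.
Proof.
rewrite /up /down comp_polyB comp_polyZ comp_polyX -polyC1 comp_polyC polyC1.
by rewrite scalerA mulfV ?pnatr_eq0// scale1r addrK.
Qed.

(** The cofactor carried to [[-1, 1]], scaled by [c^-1] to take the value [m.+1] at 1. *)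
Let P : {poly R} := c^-1 *: (Q \Po up).

Let size_up : size up = 2%N.
Proof.
by rewrite /up size_scale ?invr_eq0 ?pnatr_eq0// -(opprK 1) -polyCN size_XsubC.
Qed.

Let size_P : size P = m.+1.
Proof.
rewrite /P size_scale ?invr_eq0// size_comp_poly2//.
have Q0 : Q != 0.
  apply/eqP => Q0; move: facQ; rewrite Q0 mulr0 => CC.
  by move: sC; rewrite CC size_poly0.
have X0 : 'X - 1 != 0 :> {poly R} by rewrite -polyC1 polyXsubC_eq0.
have s3 : size ('X * ('X - 1) : {poly R}) = 3%N.
  by rewrite mulrC size_mulX// -polyC1 size_XsubC.
have := sC; rewrite facQ size_mul ?s3//; last by rewrite -size_poly_eq0 s3.
by rewrite /k !addSn add0n /= => /eq_add_S/eq_add_S.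
Qed.

Lemma lim_eigenpoly_is_jacobi : is_jacobi11 m P.
Proof.
split; first exact: size_P.
  move=> G sG.
  have [A EA A01] : null01 (C * (G \Po down)).
    apply: lim_eigenpoly_null01; rewrite size_comp_poly2//.
    by rewrite /down size_polyDl ?size_scale ?size_polyX ?size_polyN ?size_poly1 ?pnatr_eq0.
  (* At [x = (t + 1) / 2], [x (x - 1) = - (1 - t) (1 + t) / 4], and the chain rule contributes
     another [1 / 2]; hence the constant -8. *)
  have EB : ((- 8 * c^-1) *: (A \Po up))^`() = (1 - 'X) * (1 + 'X) * P * G.
    rewrite derivZ deriv_comp EA comp_polyM -comp_polyA down_up comp_polyXr.
    rewrite [in LHS]facQ !comp_polyM comp_polyB comp_polyX.
    rewrite (_ : 1 \Po up = 1); last by rewrite -polyC1 comp_polyC.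
    rewrite /P; move: (Q \Po up) => q.
    rewrite /up derivZ derivD derivX derivC addr0.
    have half : 2%:P * (2^-1)%:P = 1 :> {poly R} by rewrite -polyCM mulfV// pnatr_eq0.
    rewrite -!mul_polyC polyCM; move: ((2^-1)%:P) half (c^-1%:P) => a half d.
    have -> : (- 8)%:P = - (2%:P * 2%:P * 2%:P) :> {poly R}.
      by rewrite -!polyCM -polyCN; congr (_%:P); ring.
    move: (2%:P) half (polyC_natr R 2) => b half Eb.
    have -> : a * ('X + 1) - 1 = a * ('X + 1 - b) by rewrite mulrBr (mulrC a b) half.
    transitivity (- (b * a) * (b * a) * (b * a) * d * (('X + 1) * ('X + 1 - b) * q * G)).
      by ring.
    by rewrite half Eb; ring.
  have lt : -1 < 1 :> R by lra.
  have up1 : up.[1] = 1 by rewrite /up !hornerE; lra.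
  have upN1 : up.[-1] = 0 by rewrite /up !hornerE; lra.
  transitivity (\int[@lebesgue_measure R]_(t in `[-1, 1])
      (((1 - 'X) * (1 + 'X) * P * G).[t])).
    by apply: eq_Rintegral => t _; rewrite -jacobi_weight_horner.
  by rewrite (Rintegral_horner lt EB) !hornerZ !horner_comp up1 upN1 A01 subrr.
have Q1 : Q.[1] = c * m.+1%:R by exact: lim_eigenpoly_cofactor1.
have up1 : up.[1] = 1 by rewrite /up !hornerE; lra.
by rewrite /P hornerZ horner_comp up1 Q1 mulrA mulVf ?mul1r.
Qed.

Lemma pstar_lim_eigenpoly : pstar R k = C.
Proof.
rewrite /pstar {1}/k (_ : (m.+2 - 2)%N = m) ?subn2// (jacobi11E lim_eigenpoly_is_jacobi).
rewrite /P comp_polyZ -comp_polyA up_down comp_polyXr.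
rewrite -scalerAr scalerA [in RHS]facQ.
rewrite (_ : k`!%:R * m`!%:R / ((2 * k).-2)`!%:R = c); last by rewrite /c !subn2.
by rewrite mulfV// scale1r.
Qed.

End limit_is_jacobi.

(** * Eigenpolynomials of the two operators *)

Section eigenpolynomials.
Variable R : realType.
Implicit Types (p q C : {poly R}).

(** The eigenvalue equation only constrains values on [[0, 1]], but these already determine a
    polynomial. *)
Lemma eigenpoly_triopP (T : (R -> R) -> R -> R) (t : nat -> {poly R}) (lam : R) p :
    (forall p x, 0 <= x <= 1 -> T (fun u => p.[u]) x = (triop t p).[x]) ->
  Defs.eigenpoly T lam p <-> triop t p = lam *: p.
Proof.
move=> Tt; split=> [Ep|Ep x x01]; last by rewrite Tt// Ep hornerZ.
by apply: poly_eq_on01 => x x01; rewrite -Tt// Ep// hornerZ.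
Qed.

Lemma eigenpoly_beta (n : nat) (lam : R) p : (1 <= n)%N ->
  Defs.eigenpoly (genuine_beta n) lam p <-> triop (beta_mono R n) p = lam *: p.
Proof. by move=> n1; apply: eigenpoly_triopP => q x; exact: genuine_beta_horner. Qed.

Lemma eigenpoly_bernstein (n : nat) (lam : R) p :
  Defs.eigenpoly (bernstein n) lam p <-> triop (bern_mono R n) p = lam *: p.
Proof. by apply: eigenpoly_triopP => q x _; exact: bernstein_horner. Qed.

Lemma q_spec (n k : nat) : (2 <= k)%N -> (1 <= n)%N ->
  monic_eigenpoly (genuine_beta n) k (eta_ R n k) (q_ R n k).
Proof.
move=> k2 n1; suff : exists q, monic_eigenpoly (genuine_beta n) k (eta_ R n k) q.
  by case: k k2 => [//|[//|k]] _; exact: xgetPex.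
have [i ik|p [mp sp Ep]] := triop_eigenpoly_exists (@size_beta_mono R n) (k := k).
  by rewrite !lead_beta_monoE// eta_neq.
exists p; split=> //; apply/eigenpoly_beta => //.
by rewrite Ep lead_beta_monoE.
Qed.

Lemma q_triop (n k : nat) : (2 <= k)%N -> (1 <= n)%N ->
  [/\ q_ R n k \is monic, size (q_ R n k) = k.+1 &
      triop (beta_mono R n) (q_ R n k) = (beta_mono R n k)`_k *: q_ R n k].
Proof.
move=> k2 n1; have [mq sq /(eigenpoly_beta _ _ n1)Eq] := q_spec k2 n1.
by split=> //; rewrite Eq lead_beta_monoE.
Qed.

Lemma p_triop (n k : nat) : (2 <= k)%N -> (k <= n)%N ->
  [/\ p_ R n k \is monic, size (p_ R n k) = k.+1 &
      triop (bern_mono R n) (p_ R n k) = (bern_mono R n k)`_k *: p_ R n k].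
Proof.
move=> k2 kn; have n1 : (1 <= n)%N by apply: leq_trans kn; exact: ltnW.
suff [mp sp /eigenpoly_bernstein Ep] : monic_eigenpoly (bernstein n) k (lambda_ R n k) (p_ R n k).
  by split=> //; rewrite Ep lead_bern_monoE.
suff : exists p, monic_eigenpoly (bernstein n) k (lambda_ R n k) p.
  by case: k k2 {kn} => [//|[//|k]] _; exact: xgetPex.
have [i ik|p [mp sp Ep]] :=
    triop_eigenpoly_exists (fun j => @size_bern_mono R n j n1) (k := k).
  by rewrite !lead_bern_monoE ?lambda_neq// ltnW// (leq_trans ik).
exists p; split=> //; apply/eigenpoly_bernstein.
by rewrite Ep lead_bern_monoE.
Qed.

Lemma eta_eigenvector (n k : nat) : (1 <= n)%N -> exists p,
  size p = k.+1 /\ Defs.eigenpoly (genuine_beta n) (eta_ R n k) p.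
Proof.
move=> n1; have n0 : n%:R != 0 :> R by rewrite pnatr_eq0 -lt0n.
have [k2|k2] := leqP 2 k.
  by have [_ sq Eq] := q_spec k2 n1; exists (q_ R n k).
(* The double eigenvalue 1 is attained at [1] and [x], which the operator fixes. *)
exists 'X^k; rewrite size_polyXn; split=> //; apply/eigenpoly_beta => //.
rewrite triopXn; case: k k2 => [|[|//]] _.
  by rewrite eta0// scale1r /beta_mono big_ord0 expr0.
rewrite eta1// scale1r /beta_mono big_ord_recl big_ord0 mulr1 /= !addr0.
by rewrite scalerA mulVf// scale1r expr1.
Qed.

Lemma beta_eigenvalueE (n : nat) (lam : R) p : (1 <= n)%N -> p != 0 ->
  Defs.eigenpoly (genuine_beta n) lam p -> lam = eta_ R n (size p).-1.
Proof.
move=> n1 p0 /(eigenpoly_beta _ _ n1).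
by move/(triop_eigenvalue (@size_beta_mono R n) p0) => ->; rewrite lead_beta_monoE.
Qed.

Lemma q_unique (n k : nat) q : (2 <= k)%N -> (1 <= n)%N ->
  monic_eigenpoly (genuine_beta n) k (eta_ R n k) q -> q = q_ R n k.
Proof.
move=> k2 n1 [mq sq /(eigenpoly_beta _ _ n1)Eq].
have [mQ sQ EQ] := q_triop k2 n1.
apply: (triop_eigenpoly_unique (@size_beta_mono R n) (k := k)) => //.
  by move=> i ik; rewrite !lead_beta_monoE// eta_neq.
by rewrite lead_beta_monoE.
Qed.

Lemma prod_ord_split (f : nat -> R) (j k : nat) : (j <= k)%N ->
  \prod_(l < k) f l = (\prod_(l < j) f l) * \prod_(j <= l < k) f l.
Proof.
by move=> jk; rewrite -!(big_mkord xpredT) -big_cat_nat.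
Qed.

Lemma q_coef (n k i : nat) : (2 <= k)%N -> (1 <= n)%N -> (i < k)%N ->
  (q_ R n k)`_i =
    (\sum_(i.+1 <= j < k.+1)
       (-1) ^+ (j - i - 1) * (stirling1 j i)%:~R *
       (\prod_(j <= m < k) (n%:R + m%:R)) * (q_ R n k)`_j) /
    (\prod_(i <= m < k) (n%:R + m%:R) - n%:R ^+ (k - i)).
Proof.
move=> k2 n1 ik; have [_ sq Eq] := q_triop k2 n1.
have n0 : n%:R != 0 :> R by rewrite pnatr_eq0 -lt0n.
have ni0 : n%:R ^+ i != 0 :> R by rewrite expf_neq0.
have h := triop_eigenpoly_coef (@size_beta_mono R n) sq Eq ik.
have P0 j := beta_prod_neq0 R j n1.
(* The multiplier that clears the denominators of the triangular recursion and removes the power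
   [n ^ i] carried by each coefficient of degree [i]. *)
pose M : R := (\prod_(l < k) (n%:R + l%:R)) / n%:R ^+ i.
have den : M * ((beta_mono R n k)`_k - (beta_mono R n i)`_i) =
    - (\prod_(i <= m < k) (n%:R + m%:R) - n%:R ^+ (k - i)).
  rewrite !lead_beta_mono /M mulrBr opprB.
  rewrite -[in X in X / \prod_(l < k) _](subnK (ltnW ik)) exprD.
  have := P0 i; have := P0 k.
  rewrite (prod_ord_split (fun l => n%:R + l%:R) (ltnW ik)).
  move: (\prod_(i <= l < k) _) (\prod_(l < i) _) ni0 (n%:R ^+ (k - i)) => x y z0 u xy0 y0.
  have x0 : x != 0 by move: xy0; rewrite mulf_eq0 negb_or => /andP[].
  by field; rewrite ?z0 ?y0 ?x0.
have d0 : \prod_(i <= m < k) (n%:R + m%:R) - n%:R ^+ (k - i) != 0 :> R.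
  rewrite -oppr_eq0 -den mulf_neq0 ?mulf_neq0 ?invr_eq0//.
  by rewrite subr_eq0 eq_sym !lead_beta_monoE// eta_neq.
apply: (mulIf d0); rewrite divfK//.
apply: oppr_inj; rewrite -mulrN -den mulrCA h mulr_sumr -sumrN.
rewrite big_nat [RHS]big_nat; apply: eq_bigr => j /andP[ij jk].
rewrite coef_beta_mono_stirling// /M (prod_ord_split (fun l => n%:R + l%:R) (_ : j <= k)%N)//.
(* [j + i] and [j - i - 1] have opposite parity; the resulting sign cancels the one in [den]. *)
rewrite -(_ : - (-1) ^+ (j - i - 1) = (-1) ^+ (j + i) :> R); last first.
  rewrite (_ : j + i = (j - i - 1).+1 + (i + i))%N; last by lia.
  by rewrite exprD [X in _ * X]exprD -exprMn mulrNN mulr1 expr1n mulr1 exprS mulN1r.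
have := P0 j; move: (\prod_(j <= l < k) _) (\prod_(l < j) _) => x y y0.
by field; rewrite ?ni0 ?y0.
Qed.

(** On [[0, 1]] powers of [x] are at most 1, so the distance of two polynomials of size at most [N]
    is bounded by the sum of their [N] coefficient differences. *)
Lemma coef_cvg_uniform (q : nat -> {poly R}) C (N : nat) :
    (\forall n \near \oo, size (q n) <= N)%N -> (size C <= N)%N -> coef_cvg q C ->
  {uniform `[0, 1], (fun (n : nat) (x : R) => (q n).[x]) @ \oo --> (fun x : R => C.[x])}.
Proof.
move=> sq sC qC P /uniform_nbhs[E [entE EP]].
have [e /= e0 eE] : exists2 e : R, 0 < e & [set xy : R * R | ball xy.1 e xy.2] `<=` E.
  by move: entE; rewrite -entourage_ballE => -[e e0 h]; exists e.
have sum0 : (\sum_(j <- iota 0 N) `|C`_j - (q n)`_j|) @[n --> \oo] --> (0 : R).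
  rewrite [X in _ --> X](_ : 0 = \sum_(j <- iota 0 N) `|C`_j - C`_j|).
    apply: cvg_seq_sum => j _; apply: cvg_norm; apply: cvgB; first exact: cvg_cst.
    exact: qC.
  by rewrite big1// => j _; rewrite subrr normr0.
have small : \forall n \near \oo, \sum_(j <- iota 0 N) `|C`_j - (q n)`_j| < e.
  exact: (cvgr_lt _ sum0).
near=> n; apply: EP => /= x; rewrite in_itv /= => /andP[x0 x1].
apply: eE => /=; rewrite /ball /=.
have sn : (size (q n) <= N)%N by near: n.
rewrite (horner_coef_wide x sC) (horner_coef_wide x sn) -sumrB.
apply: (le_lt_trans (ler_norm_sum _ _ _)).
apply: (@le_lt_trans _ _ (\sum_(j <- iota 0 N) `|C`_j - (q n)`_j|)); last by near: n.
rewrite -[X in iota 0 X]subn0 -/(index_iota 0 N) big_mkord; apply: ler_sum => j _.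
rewrite -mulrBl normrM ler_piMr// ger0_norm ?exprn_ge0// exprn_ile1.
Unshelve. all: by end_near.
Qed.

Lemma q_coef_cvg (k : nat) C : (2 <= k)%N ->
    [/\ C \is monic, size C = k.+1 & triop (lim_mono R) C = (lim_mono R k)`_k *: C] ->
  coef_cvg (fun n => q_ R n k) C.
Proof.
move=> k2 hC; apply: (eigenpoly_coef_cvg (t := beta_mono R) k2) hC.
- by apply: nearW => n j; exact: size_beta_mono.
- exact: beta_mono_second_order.
- by apply: filterS (near_ge 1) => n; exact: q_triop.
Qed.

Lemma p_coef_cvg (k : nat) C : (2 <= k)%N ->
    [/\ C \is monic, size C = k.+1 & triop (lim_mono R) C = (lim_mono R k)`_k *: C] ->
  coef_cvg (fun n => p_ R n k) C.
Proof.
move=> k2 hC; apply: (eigenpoly_coef_cvg (t := bern_mono R) k2) hC.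
- by apply: filterS (near_ge 1) => n n1 j; exact: size_bern_mono.
- exact: bern_mono_second_order.
(* The Bernstein eigenpolynomial of degree [k] is meaningful from [n = k] on, which suffices for the
   limit. *)
- by apply: filterS (near_ge k) => n; exact: p_triop.
Qed.

End eigenpolynomials.

Theorem mainTheorem5 (R : realType) :
  [/\ (* (i) *)
      (forall n : nat, (1 <= n)%N ->
        (forall lam : R,
           eigenvalue_on (genuine_beta n) [set: {poly R}] lam <->
           exists k : nat, lam = eta_ R n k) /\
        (forall lam : R,
           eigenvalue_on (genuine_beta n)
             [set p : {poly R} | (size p <= n.+1)%N] lam <->
           exists2 k : nat, (k <= n)%N & lam = eta_ R n k)),
      (* (ii) *)
      (forall n k : nat, (2 <= k)%N -> (1 <= n)%N ->
        [/\ monic_eigenpoly (genuine_beta n) k (eta_ R n k) (q_ R n k),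
            (forall q : {poly R},
               monic_eigenpoly (genuine_beta n) k (eta_ R n k) q ->
               q = q_ R n k),
            (q_ R n k)`_k = 1 &
            forall i : nat, (i < k)%N ->
              (q_ R n k)`_i =
              (\sum_(i.+1 <= j < k.+1)
                 (-1) ^+ (j - i - 1) * (stirling1 j i)%:~R *
                 (\prod_(j <= m < k) (n%:R + m%:R)) * (q_ R n k)`_j) /
              (\prod_(i <= m < k) (n%:R + m%:R) - n%:R ^+ (k - i))]),
      (* (iii) *)
      (forall k j : nat, (2 <= k)%N -> (j <= k)%N ->
        (fun n : nat => (q_ R n k)`_j) @ \oo -->
        \prod_(1 <= l < (k - j).+1)
          ((k%:R + 1 - l%:R) * (k%:R - l%:R) /
           (l%:R * (l%:R - 2 * k%:R + 1)) : R)) &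
      (* (iv) *)
      (forall k : nat,
        {uniform `[0, 1], (fun (n : nat) (x : R) => (q_ R n k).[x]) @ \oo -->
                          (fun x : R => (pstar R k).[x])} /\
        {uniform `[0, 1], (fun (n : nat) (x : R) => (p_ R n k).[x]) @ \oo -->
                          (fun x : R => (pstar R k).[x])})].
Proof.
split.
- move=> n n1; split=> lam; split.
  (* The index of the eigenvalue is the degree of the eigenvector; on the restricted space this also
     yields [k <= n]. *)
  + by move=> [p [_ p0 Ep]]; exists (size p).-1; exact: beta_eigenvalueE.
  + move=> [k ->]; have [p [sp Ep]] := eta_eigenvector R k n1.
    by exists p; split=> //; rewrite -size_poly_eq0 sp.
  + move=> [p [/= sp p0 Ep]]; exists (size p).-1; last exact: beta_eigenvalueE.
    by rewrite -ltnS; apply: leq_trans sp; rewrite prednK// size_poly_gt0.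
  + move=> [k kn ->]; have [p [sp Ep]] := eta_eigenvector R k n1.
    by exists p; split=> //=; rewrite ?sp// -size_poly_eq0 sp.
- move=> n k k2 n1; have [mq sq _] := q_triop R k2 n1; split.
  + exact: q_spec.
  + by move=> q; exact: q_unique.
  + by move: mq; rewrite monicE lead_coefE sq => /eqP.
  + by move=> i; exact: q_coef.
- move=> k j k2 jk; have [C hC] := lim_eigenpoly_exists R k2.
  have := q_coef_cvg k2 hC (i := j).
  case: hC => mC sC EC; case: k k2 jk mC sC EC => [//|[//|m]] _ jk mC sC EC.
  by rewrite (lim_eigenpoly_coef mC sC EC jk).
- case=> [|[|m]].
  + by split; apply: (@coef_cvg_uniform _ _ _ 1);
      rewrite ?size_poly1//; [apply: nearW => n; rewrite size_poly1|exact: coef_cvg_cst|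
       apply: nearW => n; rewrite size_poly1|exact: coef_cvg_cst].
  + by split; apply: (@coef_cvg_uniform _ _ _ 2);
      rewrite ?size_XsubC//; [apply: nearW => n; rewrite size_XsubC|exact: coef_cvg_cst|
       apply: nearW => n; rewrite size_XsubC|exact: coef_cvg_cst].
  + have [C hC] := @lim_eigenpoly_exists R m.+2 isT.
    have [mC sC EC] := hC; rewrite (pstar_lim_eigenpoly mC sC EC).
    split; apply: (@coef_cvg_uniform _ _ _ m.+3); rewrite ?sC//.
    * by apply: filterS (near_ge 1) => n n1; have [_ ->] := q_triop R (isT : 2 <= m.+2)%N n1.
    * exact: q_coef_cvg.
    * by apply: filterS (near_ge m.+2) => n n1; have [_ ->] := p_triop R (isT : 2 <= m.+2)%N n1.
    * exact: p_coef_cvg.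
Qed.
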